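(* Let $F$ be a $p$-adic field (characteristic zero) with odd residue characteristic and let $\mathfrak g=\mathfrak{sl}(2,F)$. Let $1_{\mathfrak g_r}$ denote the characteristic function of $\mathfrak g_r$, and let $\mathrm{FT}$ be the Fourier transform on $\mathfrak g$ defined by the trace form and an additive character $\psi$ of $F$ with conductor $\wp_F$. Then: (1) The Fourier transforms $\mathrm{FT}(1_{\mathfrak g_0})$ and $\mathrm{FT}(1_{\mathfrak g_{-1/2}})$ have support in $\mathfrak g_{0^+}:=\mathfrak g_{1/2}$ and $\mathfrak g_{(1/2)^+}:=\mathfrak g_{1}$ respectively. In particular their supports are contained in the set $\mathcal N^{\mathrm{top}}$ of topologically nilpotent elements. (2) For $k\in\frac12\mathbb N$ with $k\ge 1$, the Fourier transform $\mathrm{FT}(1_{\mathfrak g_{-k}})$ has support in $\mathfrak g_{k^+}:=\mathfrak g_{k+\frac12}$.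
   Context: Notation: $\mathcal R_F$ is the ring of integers of $F$, $\wp_F$ its prime ideal, $\varpi$ a prime element. $\psi$ has conductor $\wp_F$: it is trivial on $\wp_F$ and nontrivial on $\mathcal R_F$. Moy--Prasad lattices: every point of the Bruhat--Tits building of $G=\mathrm{SL}(2,F)$ is $G$-conjugate to a point $x_t$ ($t\in[0,1]$) of the edge joining the vertices $x_0,x_1$ with stabilizers $\mathrm{SL}(2,\mathcal R_F)$ and $\mathrm{diag}(\varpi^{-1},1)\mathrm{SL}(2,\mathcal R_F)\mathrm{diag}(\varpi,1)$. For $r\in\mathbb R$, $$\mathfrak g_{x_t,r}=\Big\{\begin{bmatrix} a&b\\c&-a\end{bmatrix}\in\mathfrak g\ :\ a\in\wp_F^{\lceil r\rceil},\ b\in\wp_F^{\lceil r-t\rceil},\ c\in\wp_F^{\lceil r+t\rceil}\Big\},$$ $\mathfrak g_{gx,r}=\mathrm{Ad}(g)\mathfrak g_{x,r}$ for $g\in G$, and $\mathfrak g_r:=\bigcup_x\mathfrak g_{x,r}$ over all points $x$ of the building. These are $\mathrm{Ad}(G)$-invariant open and closed sets. $\mathcal N^{\mathrm{top}}=\mathfrak g_{1/2}$ is the set of topologically nilpotent elements. Fourier transform: for $f\in C_c^\infty(\mathfrak g)$, $\mathrm{FT}(f)(Y)=\int_{\mathfrak g}\psi(\mathrm{trace}(XY))f(X)\,dX$ for a fixed Haar measure $dX$. The functions $1_{\mathfrak g_r}$ are bounded but not compactly supported, and $\mathrm{FT}(1_{\mathfrak g_r})$ is the Fourier transform in the sense of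 distributions: $\mathrm{FT}(1_{\mathfrak g_r})(f)=\int_{\mathfrak g_r}\mathrm{FT}(f)(X)\,dX$ for $f\in C_c^\infty(\mathfrak g)$. *)

(* Defs.v *)
From HB Require Import structures.
From mathcomp Require Import all_boot all_order all_algebra.
From mathcomp Require Import all_classical all_reals all_analysis.
From mathcomp Require Import complex.

Set Implicit Arguments.
Unset Strict Implicit.
Unset Printing Implicit Defensive.

Import Order.TTheory GRing.Theory Num.Theory.

Local Open Scope classical_set_scope.
Local Open Scope ring_scope.

(* A p-adic field is a non-archimedean local field of characteristic zero: a
   field complete for a normalized discrete valuation with finite residue
   field. [valuation] is meaningful only on nonzero elements; its value at 0 is
   arbitrary, whence the alternatives [x = 0 \/ _] below. The uniform structure
   is the one defined by the valuation. *)
HB.mixin Record isPadicField F of GRing.Field F & Uniform F := {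
  valuation : F -> int;
  valuationM : forall x y : F, x != 0 -> y != 0 ->
    valuation (x * y) = valuation x + valuation y;
  valuationD : forall x y : F, x != 0 -> y != 0 -> x + y != 0 ->
    Num.min (valuation x) (valuation y) <= valuation (x + y);
  valuation_prime : exists2 pi : F, pi != 0 & valuation pi = 1;
  entourage_valuation : @entourage F = filter_from [set: int]
    (fun n => [set xy | xy.1 - xy.2 = 0 \/ n <= valuation (xy.1 - xy.2)]);
  padic_complete : forall G : set_system F, ProperFilter G -> cauchy G ->
    exists x : F, G --> x;
  residue_finite : exists s : seq F, forall x : F, x = 0 \/ 0 <= valuation x ->
    exists2 y, y \in s & x - y = 0 \/ 1 <= valuation (x - y);
  padic_pchar0 : [pchar F] =i pred0
}.

#[short(type="padicFieldType")]
HB.structure Definition PadicField :=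
  {F of GRing.Field F & Uniform F & isPadicField F}.

Section Padic.
Variable F : padicFieldType.

(* The fractional ideal wp_F^n; wp_F^0 is the ring of integers. *)
Definition prime_pow (n : int) : set F :=
  [set x | x = 0 \/ n <= valuation x].

Definition integer_ring : set F := prime_pow 0.

Definition prime_ideal : set F := prime_pow 1.

(* [p] is the residue characteristic when p = 0 in integer_ring/prime_ideal. *)
Definition odd_residue_char : Prop :=
  exists p : nat, [/\ prime p, odd p & prime_ideal p%:R].

End Padic.

Section Groups.
Variable F : fieldType.

Definition SL2 := {g : 'M[F]_2 | \det g == 1}.

Definition traceless : {pred 'M[F]_2} := [pred X | \tr X == 0].

Fact traceless_zmod_closed : zmod_closed traceless.
Proof.
split; first by rewrite !inE mxtrace0.
by move=> X Y; rewrite !inE => /eqP trX /eqP trY; rewrite raddfB /= trX trY subr0.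
Qed.

HB.instance Definition _ := GRing.isZmodClosed.Build _ traceless
  traceless_zmod_closed.

Record sl2 := Sl2 { sl2_mx :> 'M[F]_2; _ : sl2_mx \in traceless }.

HB.instance Definition _ := [isSub for sl2_mx].
HB.instance Definition _ := [Choice of sl2 by <:].
HB.instance Definition _ := [SubChoice_isSubZmodule of sl2 by <:].
HB.instance Definition _ := isPointed.Build sl2 0.

Fact Ad_subproof (g : SL2) (X : sl2) :
  val g *m sl2_mx X *m invmx (val g) \in traceless.
Proof.
have gU : val g \in unitmx by rewrite unitmxE (eqP (valP g)) unitr1.
by rewrite inE mxtrace_mulC mulmxA mulVmx // mul1mx; case: X.
Qed.

Definition Ad (g : SL2) (X : sl2) : sl2 := Sl2 (Ad_subproof g X).

End Groups.

(* sl(2,F) carries the topology induced from 'M[F]_2. *)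
HB.instance Definition _ (F : padicFieldType) :=
  Uniform.copy (sl2 F) (initial_topology (@sl2_mx F)).

Section MoyPrasad.
Variables (R : realType) (F : padicFieldType).
Implicit Types (r t : R) (g : SL2 F) (X : sl2 F).

(* g_{x_t,r}, for x_t on the edge joining x_0 and x_1. *)
Definition MP_edge t r : set (sl2 F) :=
  [set X | [/\ prime_pow (Num.ceil r) (sl2_mx X 0 0),
               prime_pow (Num.ceil (r - t)) (sl2_mx X 0 1) &
               prime_pow (Num.ceil (r + t)) (sl2_mx X 1 0)]].

(* g_{x,r} for the point x = g x_t of the building. *)
Definition MP_lattice g t r : set (sl2 F) := Ad g @` MP_edge t r.

(* The union of g_{x,r} over all x, every point being some g x_t, t in [0,1]. *)
Definition MP_set r : set (sl2 F) :=
  [set X | exists g t, 0 <= t <= 1 /\ MP_lattice g t r X].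

End MoyPrasad.
Arguments MP_edge {R} F t r _.
Arguments MP_set {R} F r _.

Definition top_nilpotent (F : padicFieldType) : set (sl2 F) :=
  [set X | (fun n => sl2_mx X ^+ n) @ \oo --> (0 : 'M[F]_2)].
Arguments top_nilpotent F _ : clear implicits.

Definition borel (T : ptopologicalType) := g_sigma_algebraType (@open T).

(* On the locally compact, second countable groups considered here such Borel
   measures are automatically regular. *)
Definition haar_measure (R : realType) (F : padicFieldType)
    (mu : {measure set (borel (sl2 F)) -> \bar R}) : Prop :=
  [/\ forall (X : sl2 F) (A : set (borel (sl2 F))), measurable A ->
        mu [set X + Y | Y in (A : set (sl2 F))] = mu A,
      forall K : set (sl2 F), compact K -> (mu K < +oo)%E &
      forall U : set (sl2 F), open U -> U !=set0 -> (0 < mu U)%E].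

Definition Cintegral (R : realType) (d : measure_display) (T : measurableType d)
    (mu : {measure set T -> \bar R}) (D : set T) (f : T -> R[i]) : R[i] :=
  Complex (Rintegral mu D (fun x => complex.Re (f x)))
          (Rintegral mu D (fun x => complex.Im (f x))).

Section Distributions.
Variables (R : realType) (T : topologicalType).
Implicit Types (f : T -> R[i]) (D : (T -> R[i]) -> R[i]).

Definition locally_constant f : Prop := forall x, \forall y \near x, f y = f x.

Definition fun_support f : set T := closure [set x | f x != 0].

Definition test_function f : Prop :=
  locally_constant f /\ compact (fun_support f).

(* A distribution is represented by a functional on all functions, of which
   only the values at test functions matter. Its support is the complement of
   the union of the open sets on which it vanishes. *)
Definition dist_support D : set T :=
  ~` [set x | exists U : set T, [/\ open U, U x &
        forall f, test_function f -> fun_support f `<=` U -> D f = 0]].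

End Distributions.

Section Fourier.
Variables (R : realType) (F : padicFieldType).
Variables (mu : {measure set (borel (sl2 F)) -> \bar R}) (psi : F -> R[i]).

Definition FT (f : sl2 F -> R[i]) (Y : sl2 F) : R[i] :=
  Cintegral mu setT (fun X : sl2 F => psi (\tr (sl2_mx X *m sl2_mx Y)) * f X).

(* The regular distribution attached to the characteristic function of A. *)
Definition dist_ind (A : set (sl2 F)) (f : sl2 F -> R[i]) : R[i] :=
  Cintegral mu A f.

Definition dist_FT (D : (sl2 F -> R[i]) -> R[i]) (f : sl2 F -> R[i]) : R[i] :=
  D (FT f).

(* Continuity is not listed: it follows from [has_conductor_prime]. *)
Definition additive_character : Prop :=
  (forall x y, psi (x + y) = psi x * psi y) /\ (forall x, `|psi x| = 1).

Definition has_conductor_prime : Prop :=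
  (forall x, prime_ideal x -> psi x = 1) /\
  (exists2 x, integer_ring x & psi x <> 1).

End Fourier.

(* Main.v *)
Require Import Defs.
From mathcomp Require Import all_boot all_order all_algebra.
From mathcomp Require Import all_classical all_reals all_analysis.
From mathcomp Require Import measurable_realfun complex.
From mathcomp Require Import zify ring lra.

(* Every traceless matrix is SL(2,F)-conjugate to an antidiagonal one, so
   g_{h/2}, for an integer h,
     is {X : -det X in wp^h}. A test function is a finite
   combination of indicators of cosets Y + wp^m, whose Fourier transforms are
   the functions X |-> psi (tr XY) cut off to a ball. The claim is thus that the
   integral of psi (tr XY) over g_{-n/2} cut off to the ball wp^-N vanishes as
   soon as Y is not in g_{(n+1)/2}. This is an induction on N. For N =
     floor(n/2)
   the cut-off set is the whole ball, a lattice. Each further shell is a finite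
   disjoint union of differences L \ L' of two Moy-Prasad lattices, attached to
   incident facets of the tree. The dual of each of these lattices for the
   trace form lies in g_{(n+1)/2} (the residue characteristic being odd), so
   X |-> psi (tr XY) is a nontrivial character of it and has integral 0. *)

Set Implicit Arguments.
Unset Strict Implicit.
Unset Printing Implicit Defensive.

Import Order.TTheory GRing.Theory Num.Theory.

Local Open Scope classical_set_scope.
Local Open Scope ring_scope.

(** * Arithmetic of valuations and of the fractional ideals *)

Section PrimePow.
Variable F : padicFieldType.
Implicit Types (x y : F) (m n : int).

Lemma valuation1 : valuation (1 : F) = 0.
Proof.
have := @valuationM F 1 1 (oner_neq0 _) (oner_neq0 _).
by rewrite mulr1; lia.
Qed.

Lemma valuationN x : x != 0 -> valuation (- x) = valuation x.
Proof.
have N10 : (-1 : F) != 0 by rewrite oppr_eq0 oner_neq0.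
have := @valuationM F (-1) (-1) N10 N10.
rewrite mulrNN mulr1 valuation1 => h x0.
by rewrite -mulN1r valuationM//; lia.
Qed.

Lemma valuationV x : x != 0 -> valuation x^-1 = - valuation x.
Proof.
move=> x0; have xV0 : x^-1 != 0 by rewrite invr_eq0.
by have := valuationM _ _ x0 xV0; rewrite divff// valuation1; lia.
Qed.

Lemma prime_pow0 n : prime_pow n (0 : F). Proof. by left. Qed.

Lemma prime_powD n x y :
  prime_pow n x -> prime_pow n y -> prime_pow n (x + y).
Proof.
have [->|x0] := eqVneq x 0; first by rewrite add0r.
have [->|y0] := eqVneq y 0; first by rewrite addr0.
have [->|xy0] := eqVneq (x + y) 0; first by left.
move=> [/eqP|nx]; first by rewrite (negbTE x0).
move=> [/eqP|ny]; first by rewrite (negbTE y0).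
right; apply: le_trans (valuationD _ _ x0 y0 xy0).
by rewrite le_min nx.
Qed.

Lemma prime_powN n x : prime_pow n x -> prime_pow n (- x).
Proof.
have [->|x0] := eqVneq x 0; first by rewrite oppr0.
by move=> [->|nx]; [rewrite oppr0; left|right; rewrite valuationN].
Qed.

Lemma prime_powB n x y :
  prime_pow n x -> prime_pow n y -> prime_pow n (x - y).
Proof. by move=> ? ?; apply/prime_powD/prime_powN. Qed.

Lemma prime_powM m n x y :
  prime_pow m x -> prime_pow n y -> prime_pow (m + n) (x * y).
Proof.
have [->|x0] := eqVneq x 0; first by rewrite mul0r => *; left.
have [->|y0] := eqVneq y 0; first by rewrite mulr0 => *; left.
move=> [/eqP|nx]; first by rewrite (negbTE x0).
move=> [/eqP|ny]; first by rewrite (negbTE y0).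
by right; rewrite valuationM// lerD.
Qed.

Lemma prime_pow_le m n x : m <= n -> prime_pow n x -> prime_pow m x.
Proof. by move=> mn [->|nx]; [left|right; exact: le_trans nx]. Qed.

Lemma prime_powMle k m n x y : k <= m + n ->
  prime_pow m x -> prime_pow n y -> prime_pow k (x * y).
Proof. by move=> + hx hy; move/prime_pow_le; apply; exact: prime_powM. Qed.

Lemma not_prime_pow_neq0 n x : ~ prime_pow n x -> x != 0.
Proof. by apply: contra_notN => /eqP ->; left. Qed.

(** A negated membership [~ prime_pow n x] serves throughout as the upper bound n - 1 on the
    valuation of a nonzero element; hence the shifts by 1 here and in the next lemmas. *)
Lemma prime_powV n x : ~ prime_pow n x -> prime_pow (1 - n) x^-1.
Proof.
move=> nx; have x0 := not_prime_pow_neq0 nx.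
right; rewrite valuationV//; have [nvx|] := leP n (valuation x); last by lia.
by case: nx; right.
Qed.

Lemma prime_pow_div k m n x y : k <= m + 1 - n ->
  prime_pow m x -> ~ prime_pow n y -> prime_pow k (x / y).
Proof. by move=> h hx /prime_powV; apply: prime_powMle hx; lia. Qed.

Lemma not_prime_powM m n x y :
  ~ prime_pow m x -> ~ prime_pow n y -> ~ prime_pow (m + n - 1) (x * y).
Proof.
move=> nx ny; have x0 := not_prime_pow_neq0 nx;
  have y0 := not_prime_pow_neq0 ny.
move=> [/eqP|]; first by rewrite mulf_eq0 (negbTE x0) (negbTE y0).
rewrite valuationM// => h.
have [mx|] : m <= valuation x \/ n <= valuation y by lia.
- by apply: nx; right.
- by move=> ny'; apply: ny; right.
Qed.

(** Valuations are integers, so an even valuation that is at least 2n - 1 is at least 2n. *)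
Lemma prime_pow_sqr n x : prime_pow (2 * n - 1) (x ^+ 2) -> prime_pow n x.
Proof.
move=> h; apply: contrapT => nx; apply: (not_prime_powM nx nx).
by rewrite -expr2; apply: prime_pow_le h; lia.
Qed.

Lemma prime_powX n x k : prime_pow n x -> prime_pow (n * k%:Z) (x ^+ k).
Proof.
move=> nx; elim: k => [|k IH].
  by rewrite mulr0 expr0; right; rewrite valuation1.
by rewrite exprSr; apply: prime_powMle IH nx; lia.
Qed.

Lemma prime_pow1 : prime_pow 0 (1 : F).
Proof. by right; rewrite valuation1. Qed.

Lemma prime_pow_nat k : prime_pow 0 (k%:R : F).
Proof.
elim: k => [|k IH]; first by left.
by rewrite -addn1 natrD; apply: prime_powD IH _; exact: prime_pow1.
Qed.

Lemma not_prime_pow1 : ~ prime_pow 1 (1 : F).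
Proof. by move=> [/eqP|]; rewrite ?oner_eq0// valuation1. Qed.

(** If 2 were in wp, so would be 1 = p - 2 (p - 1)/2. *)
Lemma odd_not_prime2 : odd_residue_char F -> ~ prime_pow 1 (2 : F).
Proof.
move=> [p [_ podd pp]] p2; apply: not_prime_pow1.
have -> : (1 : F) = p%:R - p./2%:R * 2.
  by rewrite -{1}(odd_double_half p) podd add1n -addn1 -muln2 natrD natrM; ring.
apply: (prime_powB pp); apply: (prime_powMle _ _ p2); last exact: prime_pow_nat.
by [].
Qed.

Lemma ex_valuation (n : int) : exists2 x : F, x != 0 & valuation x = n.
Proof.
have [pi pi0 vpi] := @valuation_prime F.
have vpiX (k : nat) : valuation (pi ^+ k) = k.
  elim: k => [|k IH]; first by rewrite expr0 valuation1.
  by rewrite exprSr valuationM ?expf_neq0// IH vpi; lia.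
case: n => k; first by exists (pi ^+ k); rewrite ?expf_neq0.
by exists (pi ^- k.+1); rewrite ?valuationV ?invr_eq0 ?expf_neq0// vpiX NegzE.
Qed.

End PrimePow.

(** * Traceless matrices in coordinates and their discriminant *)

Section Coordinates.
Variable F : fieldType.
Implicit Types X Y : sl2 F.

Definition mx2 (a b c d : F) : 'M[F]_2 := \matrix_(i < 2, j < 2)
  if i == 0 then if j == 0 then a else b else if j == 0 then c else d.

Lemma mx2E a b c d : (mx2 a b c d 0 0 = a) * (mx2 a b c d 0 1 = b) *
  (mx2 a b c d 1 0 = c) * (mx2 a b c d 1 1 = d).
Proof. by rewrite !mxE. Qed.

Fact sl2_of_subproof (a b c : F) : mx2 a b c (- a) \in @traceless F.
Proof. by rewrite inE /mxtrace !big_ord_recl big_ord0 !mxE/= addr0 subrr. Qed.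

Definition sl2_of (a b c : F) : sl2 F := Sl2 (sl2_of_subproof a b c).

Lemma sl2_ofE a b c : (sl2_mx (sl2_of a b c) 0 0 = a) *
  (sl2_mx (sl2_of a b c) 0 1 = b) * (sl2_mx (sl2_of a b c) 1 0 = c).
Proof. by rewrite !mxE. Qed.

Lemma sl2_mx11 X : sl2_mx X 1 1 = - sl2_mx X 0 0.
Proof.
case: X => M /=; rewrite inE /mxtrace !big_ord_recl big_ord0 addr0.
rewrite (_ : lift ord0 ord0 = 1); last exact/val_inj.
by move/eqP; rewrite addrC => /eqP; rewrite addr_eq0 => /eqP.
Qed.

Lemma ord2 (P : 'I_2 -> Prop) : P 0 -> P 1 -> forall i, P i.
Proof.
move=> P0 P1 [[|[|//]] h]; first by have -> : Ordinal h = 0 by exact/val_inj.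
by have -> : Ordinal h = 1 by exact/val_inj.
Qed.

Lemma mulmx2E (A B : 'M[F]_2) i j :
  (A *m B) i j = A i 0 * B 0 j + A i 1 * B 1 j.
Proof.
rewrite mxE !big_ord_recl big_ord0 addr0.
by rewrite (_ : lift ord0 ord0 = 1)//; exact/val_inj.
Qed.

Lemma matrix2P (A B : 'M[F]_2) : A 0 0 = B 0 0 -> A 0 1 = B 0 1 ->
  A 1 0 = B 1 0 -> A 1 1 = B 1 1 -> A = B.
Proof. by move=> *; apply/matrixP; apply: ord2; apply: ord2. Qed.

(** This is -det X, the square of either eigenvalue; by Cayley-Hamilton it is also the scalar
    X^2. *)
Definition sl2_disc X : F :=
  sl2_mx X 0 0 ^+ 2 + sl2_mx X 0 1 * sl2_mx X 1 0.

Lemma det_matrix2 (A : 'M[F]_2) : \det A = A 0 0 * A 1 1 - A 0 1 * A 1 0.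
Proof.
rewrite (expand_det_row _ 0) !big_ord_recl big_ord0 addr0 /cofactor !det_mx11.
rewrite !mxE/= expr0 expr1 mul1r mulN1r mulrN.
by congr (_ * A _ _ - A _ _ * A _ _); exact/val_inj.
Qed.

Lemma sl2_discE X : \det (sl2_mx X) = - sl2_disc X.
Proof. by rewrite det_matrix2 sl2_mx11 /sl2_disc; ring. Qed.

Lemma sl2_mx_sqr X : sl2_mx X *m sl2_mx X = (sl2_disc X)%:M.
Proof.
by apply: matrix2P; rewrite mulmx2E !mxE/= ?sl2_mx11 /sl2_disc; ring.
Qed.

Lemma mxtrace_mul_sl2 X Y : \tr (sl2_mx X *m sl2_mx Y) =
  2 * sl2_mx X 0 0 * sl2_mx Y 0 0 + sl2_mx X 0 1 * sl2_mx Y 1 0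
  + sl2_mx X 1 0 * sl2_mx Y 0 1.
Proof.
rewrite /mxtrace !big_ord_recl big_ord0 addr0.
rewrite (_ : lift ord0 ord0 = 1); last exact/val_inj.
by rewrite !mulmx2E !sl2_mx11; ring.
Qed.

(** Conjugacy is expressed as g X = Y g, which avoids inverse matrices and turns the explicit
    conjugations below into identities between entries. *)
Lemma sl2_disc_conj X Y (g : 'M[F]_2) : \det g = 1 ->
  g *m sl2_mx X = sl2_mx Y *m g -> sl2_disc Y = sl2_disc X.
Proof.
move=> g1 /(congr1 determinant); rewrite !det_mulmx g1 mul1r mulr1 !sl2_discE.
by move=> /oppr_inj.
Qed.

End Coordinates.

(** * Moy-Prasad sets as level sets of the discriminant *)

Section MoyPrasadSets.
Variables (R : realType) (F : padicFieldType).
Implicit Types (r t : R) (X Y : sl2 F) (g : 'M[F]_2).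

Lemma MP_set_conj r X Y g : \det g = 1 -> g *m sl2_mx X = sl2_mx Y *m g ->
  MP_set F r X -> MP_set F r Y.
Proof.
move=> g1 gXY [[h h1] [t [t01 [Z HZ ZX]]]].
have gh1 : \det (g *m h) == 1 by rewrite det_mulmx g1 mul1r.
exists (exist _ (g *m h) gh1), t; split=> //; exists Z => //.
apply: val_inj => /=; move: gXY; rewrite -ZX /= => gXY.
have hU : h \in unitmx by rewrite unitmxE (eqP h1) unitr1.
have gU : g \in unitmx by rewrite unitmxE g1 unitr1.
have ghU : g *m h \in unitmx by rewrite unitmx_mul gU.
apply: (can_inj (mulmxK ghU)); rewrite mulmxKV//.
by rewrite !mulmxA -gXY !mulmxA mulmxKV.
Qed.

Lemma MP_edge_set r t X : 0 <= t <= 1 -> MP_edge F t r X -> MP_set F r X.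
Proof.
move=> t01 HX.
have I1 : \det (1%:M : 'M[F]_2) == 1 by rewrite det1.
exists (exist _ 1%:M I1), t; split=> //; exists X => //.
apply: val_inj; rewrite /= mul1mx.
by rewrite (_ : invmx 1%:M = 1%:M) ?mulmx1// invmx1.
Qed.

(** Rounding up only helps: the exponents of the two off-diagonal entries add up to at least (r - t)
    + (r + t) = 2r = h, and twice the exponent of the diagonal entry is at least h as well. *)
Lemma MP_edge_disc (h : int) t X :
  MP_edge F t (h%:~R / 2 : R) X -> prime_pow h (sl2_disc X).
Proof.
case=> Ha Hb Hc; apply: prime_powD; last first.
  apply: (prime_powMle _ Hb Hc).
  rewrite -(ler_int R) rmorphD/=.
  by apply: le_trans (lerD (ceil_ge _) (ceil_ge _)); lra.
rewrite expr2; apply: (prime_powMle _ Ha Ha).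
rewrite -(ler_int R) rmorphD/=.
by apply: le_trans (lerD (ceil_ge _) (ceil_ge _)); lra.
Qed.

Lemma MP_set_disc (h : int) X :
  MP_set F (h%:~R / 2 : R) X -> prime_pow h (sl2_disc X).
Proof.
move=> [[g g1] [t [t01 [Z HZ <-]]]].
have := MP_edge_disc HZ; rewrite (@sl2_disc_conj _ Z _ g) //; first exact/eqP.
rewrite /= mulmxKV// unitmxE (eqP g1) unitr1//.
Qed.

(** The point x_t with t = h/2 - i has r - t = i and r + t = h - i for r = h/2; the bounds on h - 2i
    say that t is in [0,1]. *)
Lemma MP_edge_antidiag (h i : int) X : 0 <= h - 2 * i <= 2 ->
  sl2_mx X 0 0 = 0 -> prime_pow i (sl2_mx X 0 1) ->
  prime_pow (h - i) (sl2_mx X 1 0) -> MP_set F (h%:~R / 2 : R) X.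
Proof.
rewrite -(ler_int R) -(ler_int R) !rmorphB !rmorphM/= => hi a0 Hb Hc.
apply: (@MP_edge_set _ (h%:~R / 2 - i%:~R)); first by lra.
split; first by rewrite a0; left.
- by apply: prime_pow_le Hb; rewrite ceil_le_int; lra.
- by apply: prime_pow_le Hc; rewrite ceil_le_int rmorphB/=; lra.
Qed.

(** Diagonal conjugation by an element of valuation k raises i by 2k and so lowers h - 2i by 4k,
    which brings it into [-1, 2]. The values 0, 1, 2 belong to points of the edge, and the Weyl
    element exchanges -1 for 1. *)
Lemma MP_set_antidiag (h i : int) X :
  sl2_mx X 0 0 = 0 -> prime_pow i (sl2_mx X 0 1) ->
  prime_pow (h - i) (sl2_mx X 1 0) -> MP_set F (h%:~R / 2 : R) X.
Proof.
move=> a0 Hb Hc.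
pose k := ((h - 2 * i + 1) %/ 4)%Z.
have hk : -1 <= h - 2 * (i + 2 * k) <= 2.
  have := divz_eq (h - 2 * i + 1) 4; rewrite -/k.
  have := @modz_ge0 (h - 2 * i + 1) 4 isT.
  have := @ltz_mod (h - 2 * i + 1) 4 isT.
  by lia.
have [u u0 vu] := ex_valuation F k.
have uV0 : u^-1 != 0 by rewrite invr_eq0.
pose b := u ^+ 2 * sl2_mx X 0 1; pose c := u^-1 ^+ 2 * sl2_mx X 1 0.
have Pu : prime_pow k u by right; rewrite vu.
have PuV : prime_pow (- k) u^-1 by right; rewrite valuationV// vu.
have Hb' : prime_pow (i + 2 * k) b.
  by apply: (prime_powMle _ (prime_powX 2 Pu) Hb); lia.
have Hc' : prime_pow (h - (i + 2 * k)) c.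
  by apply: (prime_powMle _ (prime_powX 2 PuV) Hc); lia.
apply: (@MP_set_conj _ (sl2_of 0 b c) _ (mx2 u^-1 0 0 u)).
- by rewrite det_matrix2 !mx2E mulVf// mul0r subr0.
- apply: matrix2P; rewrite !mulmx2E !mx2E ?sl2_mx11 ?a0 /b /c; by field.
have [ge0|lt0] := leP 0 (h - 2 * (i + 2 * k)).
  by apply: (@MP_edge_antidiag _ (i + 2 * k)); rewrite ?sl2_ofE//; lia.
apply: (@MP_set_conj _ (sl2_of 0 (- c) (- b)) _ (mx2 0 1 (-1) 0)).
- by rewrite det_matrix2 !mx2E; ring.
- by apply: matrix2P; rewrite !mulmx2E !mx2E; ring.
apply: (@MP_edge_antidiag _ (h - (i + 2 * k))); rewrite ?sl2_ofE//;
  first by lia.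
- exact: prime_powN.
- by apply: prime_powN; rewrite opprB addrC subrK.
Qed.

(** A lower unipotent conjugation clears the diagonal. Invariance of the discriminant forces the new
    lower entry to be disc/b, and [MP_set_antidiag] applies with i the valuation of b. *)
Lemma MP_set_upper (h : int) X : sl2_mx X 0 1 != 0 ->
  prime_pow h (sl2_disc X) -> MP_set F (h%:~R / 2 : R) X.
Proof.
set a := sl2_mx X 0 0; set b := sl2_mx X 0 1 => b0 hX.
pose c := sl2_disc X / b.
apply: (@MP_set_conj _ (sl2_of 0 b c) _ (mx2 1 0 (- (a / b)) 1)).
- by rewrite det_matrix2 !mx2E; ring.
- apply: matrix2P; rewrite !mulmx2E !mx2E ?sl2_mx11 /c /sl2_disc -/a -/b;
    by field.
apply: (@MP_set_antidiag _ (valuation b)); rewrite ?sl2_ofE//; first by right.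
apply: (prime_powMle _ hX); first exact: lexx.
by right; rewrite valuationV.
Qed.

(** One inclusion is the invariance of the discriminant. For the other, every nonzero X has a
    conjugate with nonzero upper right entry, to which [MP_set_upper] applies. *)
Lemma MP_setE (h : int) : MP_set F (h%:~R / 2 : R) =
  [set X | prime_pow h (sl2_disc X)].
Proof.
apply/seteqP; split=> X /=; first exact: MP_set_disc.
have [b0|b0] := eqVneq (sl2_mx X 0 1) 0; last exact: MP_set_upper.
move=> hX; have [c0|c0] := eqVneq (sl2_mx X 1 0) 0.
  have [a0|a0] := eqVneq (sl2_mx X 0 0) 0.
    apply: (@MP_set_antidiag _ 0); rewrite ?b0 ?c0//; left => //.
  (* For X diagonal and nonzero, an upper unipotent conjugation creates the entry -2a, nonzero in
     characteristic 0. *)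
  apply: (@MP_set_conj _ (sl2_of (sl2_mx X 0 0) (- (2 * sl2_mx X 0 0)) 0) _
    (mx2 1 (-1) 0 1)).
  - by rewrite det_matrix2 !mx2E; ring.
  - apply: matrix2P; rewrite !mulmx2E !mx2E ?sl2_mx11 ?b0 ?c0; by ring.
  apply: MP_set_upper; last first.
    by move: hX; rewrite /sl2_disc !sl2_ofE b0 c0 !mulr0.
  rewrite sl2_ofE oppr_eq0 mulf_neq0//.
  by have := @padic_pchar0 F 2; rewrite !inE/= => /negbT.
(* The Weyl element moves the nonzero lower left entry to the upper right. *)
apply: (@MP_set_conj _ (sl2_of (- sl2_mx X 0 0) (- sl2_mx X 1 0)
  (- sl2_mx X 0 1))
  _ (mx2 0 1 (-1) 0)).
- by rewrite det_matrix2 !mx2E; ring.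
- by apply: matrix2P; rewrite !mulmx2E !mx2E ?sl2_mx11; ring.
apply: MP_set_upper; first by rewrite sl2_ofE oppr_eq0.
by move: hX; rewrite /sl2_disc !sl2_ofE mulrNN sqrrN [X in _ + X]mulrC.
Qed.

End MoyPrasadSets.

(** * The topology of sl(2,F) and topological nilpotence *)

Section Topology.
Variable F : padicFieldType.
Implicit Types (X Y Z : sl2 F) (x y : F).

Lemma sl2_mxD X Y i j : sl2_mx (X + Y) i j = sl2_mx X i j + sl2_mx Y i j.
Proof. by rewrite -[sl2_mx (X + Y)]/(val (X + Y)) raddfD mxE. Qed.

Lemma sl2_mxN X i j : sl2_mx (- X) i j = - sl2_mx X i j.
Proof. by rewrite -[sl2_mx (- X)]/(val (- X)) raddfN mxE. Qed.

Lemma sl2_mxB X Y i j : sl2_mx (X - Y) i j = sl2_mx X i j - sl2_mx Y i j.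
Proof. by rewrite sl2_mxD sl2_mxN. Qed.

(** These lattices form a basis of neighbourhoods of 0 ([nbhs_sl2P]); with negative exponents they
    are the balls of the cut-offs. *)
Definition sl2_box (e : int) : set (sl2 F) :=
  [set X | [/\ prime_pow e (sl2_mx X 0 0), prime_pow e (sl2_mx X 0 1) &
               prime_pow e (sl2_mx X 1 0)]].

Lemma sl2_box_entry e X i j : sl2_box e X -> prime_pow e (sl2_mx X i j).
Proof.
case=> h00 h01 h10; move: i j; apply: ord2; apply: ord2 => //.
by rewrite sl2_mx11; exact: prime_powN.
Qed.

Lemma sl2_box_le d e X : d <= e -> sl2_box e X -> sl2_box d X.
Proof. by move=> de [? ? ?]; split; exact: prime_pow_le de _. Qed.

Lemma sl2_boxD e X Y : sl2_box e X -> sl2_box e Y -> sl2_box e (X + Y).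
Proof. by move=> [? ? ?] [? ? ?]; split; rewrite sl2_mxD;
  exact: prime_powD. Qed.

Lemma sl2_boxN e X : sl2_box e X -> sl2_box e (- X).
Proof. by move=> [? ? ?]; split; rewrite sl2_mxN; exact: prime_powN. Qed.

Lemma entourage_padicP (A : set (F * F)) :
  entourage A <-> exists e, forall x y, prime_pow e (x - y) -> A (x, y).
Proof.
rewrite entourage_valuation; split=> [[e _ eA]|[e eA]].
  by exists e => x y xy; apply: eA.
by exists e => // -[x y]; exact: eA.
Qed.

Lemma nbhs_sl2P X (U : set (sl2 F)) :
  nbhs X U <-> exists e, forall Z, sl2_box e Z -> U (X + Z).
Proof.
split.
  move=> /nbhsP [V [W [P entP sP] sB] BU].
  have /choice [e eP] : forall ij : 'I_2 * 'I_2, exists e,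
      forall x y, prime_pow e (x - y) -> P ij.1 ij.2 (x, y).
    by move=> ij; apply/entourage_padicP.
  exists (\big[Num.max/0]_ij e ij) => Z HZ; apply: BU;
    apply/xsectionP/sB/sP => /= i j.
  apply: (eP (i, j)); rewrite sl2_mxD opprD addNKr.
  by apply: prime_powN; apply: prime_pow_le (sl2_box_entry i j HZ);
    exact: le_bigmax.
move=> [e eU]; apply/nbhsP.
exists [set XY : sl2 F * sl2 F | forall i j,
  prime_pow e (sl2_mx XY.1 i j - sl2_mx XY.2 i j)].
  exists [set MN : 'M[F]_2 * 'M[F]_2 | forall i j,
    prime_pow e (MN.1 i j - MN.2 i j)] => //.
  exists (fun _ _ => [set xy : F * F | prime_pow e (xy.1 - xy.2)]) => //.
  by move=> i j; apply/entourage_padicP; exists e.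
move=> Y /xsectionP /= h; rewrite (_ : Y = X + (Y - X));
  last by rewrite addrC subrK.
by apply: eU; split; rewrite sl2_mxB -opprB; apply: prime_powN; exact: h.
Qed.

Lemma open_sl2P (U : set (sl2 F)) :
  open U <-> forall X, U X -> exists e, forall Z, sl2_box e Z -> U (X + Z).
Proof.
rewrite openE; split => h X /h; first by move/nbhs_sl2P.
by move=> ?; apply/nbhs_sl2P.
Qed.

Lemma ex_sl2_box X : exists e, sl2_box e X.
Proof.
have H x : exists e, prime_pow e x by exists (valuation x); right.
have [e0 h0] := H (sl2_mx X 0 0); have [e1 h1] := H (sl2_mx X 0 1).
have [e2 h2] := H (sl2_mx X 1 0).
exists (Num.min e0 (Num.min e1 e2)); split; [move: h0|move: h1|move: h2];
  by apply: prime_pow_le; rewrite !ge_min lexx ?orbT.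
Qed.

(** Since X^2 is the scalar [sl2_disc X] in wp, the power X^(2m) lies in wp^m; an odd power has one
    more factor X, whose entries are in wp^d. *)
Lemma top_nilpotentE X : prime_pow 1 (sl2_disc X) -> top_nilpotent F X.
Proof.
move=> X1; have [d HX] := ex_sl2_box X.
have HXn n : forall i j,
    prime_pow (n./2%:Z + Num.min 0 d) ((sl2_mx X ^+ n) i j).
  have E m : sl2_mx X ^+ m.*2 = (sl2_disc X ^+ m)%:M.
    rewrite -mul2n exprM expr2 -[_ * _]/(sl2_mx X *m sl2_mx X) sl2_mx_sqr.
    by rewrite -rmorphXn.
  have P (m : nat) : prime_pow m (sl2_disc X ^+ m).
    by apply: prime_pow_le (prime_powX m X1); lia.
  move=> i j; rewrite -[in X in prime_pow _ X](odd_double_half n).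
  case: (odd n).
    rewrite addSn add0n exprSr E -[_ * _]/(_ *m _) mul_scalar_mx mxE.
    apply: prime_powMle (P _) (sl2_box_entry i j HX); lia.
  rewrite add0n E mxE; case: (i == j); rewrite ?mulr1n ?mulr0n; last by left.
  by apply: prime_pow_le (P _); lia.
move=> U [P HP sP].
have /choice [e eP] : forall ij : 'I_2 * 'I_2, exists e,
    forall y, prime_pow e y -> P ij.1 ij.2 y.
  move=> [i j]; have /nbhsP [A /entourage_padicP [e eA] AP] := HP i j.
  exists e => y hy; apply/AP/xsectionP/eA; rewrite mxE sub0r.
  exact: prime_powN.
pose m := \big[Num.max/0]_ij e ij.
(* Half of such an n is at least |m| + |d|, which absorbs the loss [Num.min 0 d]. *)
exists (`|m|%N.*2 + (`|d|%N).*2)%N => // n /= hn; apply: sP => i j.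
apply: (eP (i, j)); apply: prime_pow_le (HXn n i j).
have : e (i, j) <= m by exact: le_bigmax.
lia.
Qed.

End Topology.

(** * Compactness of the balls and uniformity of test functions *)

Section Compactness.
Variable F : padicFieldType.
Implicit Types (X Y Z : sl2 F) (x y : F).

(** The residue field being finite, a net modulo wp^n is refined to one modulo wp^(n+1) by adding
    residue representatives times an element of valuation n. Scaling reduces wp^e to the ring of
    integers. *)
Lemma prime_pow_net (e m : int) : exists s : seq F,
  (forall y, y \in s -> prime_pow e y) /\
  forall x, prime_pow e x -> exists2 y, y \in s & prime_pow m (x - y).
Proof.
suff H (n : nat) : exists s : seq F, forall x, prime_pow 0 x ->
    exists2 y, y \in s & prime_pow n (x - y).
  have [u u0 vu] := ex_valuation F e.
  have Pu : prime_pow e u by right; rewrite vu.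
  have PuV : prime_pow (- e) u^-1 by right; rewrite valuationV// vu.
  have [s sP] := H `|m - e|%N.
  (* The net [s] may contain non-integral points; discarding those that scale to points outside wp^e
     loses none that approximates a point of wp^e. *)
  exists [seq y <- [seq u * z | z <- s] | `[< prime_pow e y >]]; split.
    by move=> y; rewrite mem_filter => /andP[/asboolP].
  move=> x ex; have [|z zs xz] := sP (x / u);
    first by apply: prime_powMle ex PuV; lia.
  have xuz : prime_pow (e + `|m - e|%N) (x - u * z).
    by rewrite (_ : x - u * z = u * (x / u - z)); [exact: prime_powM|field].
  exists (u * z); last by apply: prime_pow_le xuz; lia.
  rewrite mem_filter map_f// andbT; apply/asboolP.
  rewrite (_ : u * z = x - (x - u * z)); last by ring.
  by apply: (prime_powB ex); apply: prime_pow_le xuz; lia.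
elim: n => [|n [s sP]].
  by exists [:: 0] => x x0; exists 0; rewrite ?inE// subr0.
have [t tP] := @residue_finite F.
have [u u0 vu] := ex_valuation F n.
have Pu : prime_pow n u by right; rewrite vu.
have PuV : prime_pow (- n%:Z) u^-1 by right; rewrite valuationV// vu.
exists [seq y + u * z | y <- s, z <- t] => x x0.
have [y ys xy] := sP x x0.
have [|z zt xyz] := tP ((x - y) / u).
  by apply: (@prime_powMle _ 0 _ _ _ _ _ xy PuV); lia.
exists (y + u * z); first by apply/allpairsP; exists (y, z).
rewrite (_ : x - _ = u * ((x - y) / u - z)); last by field.
by apply: prime_powMle Pu xyz; lia.
Qed.

Lemma sl2_box_net (e m : int) : exists s : seq (sl2 F),
  forall X, sl2_box e X -> exists2 Y, Y \in s & sl2_box m (X - Y).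
Proof.
have [s [_ sP]] := prime_pow_net e m.
exists [seq sl2_of p.1 p.2 z | p <- [seq (x, y) | x <- s, y <- s], z <- s].
move=> X [/sP [a sa Xa] /sP [b sb Xb] /sP [c sc Xc]].
exists (sl2_of a b c); last by split; rewrite sl2_mxB sl2_ofE.
apply/allpairsP; exists ((a, b), c); split=> //.
by apply/allpairsP; exists (a, b).
Qed.

Lemma ultra_seq_cover (T : Type) (I : eqType) (G : set_system T)
    (s : seq I) (Q : I -> set T) : UltraFilter G ->
  G [set x | exists2 i, i \in s & Q i x] -> exists2 i, i \in s & G (Q i).
Proof.
move=> UG; elim: s => [|i s IH] Gs.
  by have /filter_ex [x [j]] := Gs; rewrite in_nil.
have [?|Gi] := in_ultra_setVsetC (Q i) UG; first by exists i; rewrite ?mem_head.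
have [|j js Gj] := IH; last by exists j; rewrite // inE js orbT.
apply: filterS2 Gs Gi => x [j]; rewrite inE => /predU1P[->//|js] Qj _.
by exists j.
Qed.

(** Finitely many cosets of any smaller ball cover this one, so an ultrafilter on it contains such a
    coset at every level. Each entry is then Cauchy and converges by completeness of F. *)
Lemma compact_sl2_box e : compact (sl2_box e : set (sl2 F)).
Proof.
rewrite compact_ultra => G UG Ge.
have small m : exists Y, G [set X | sl2_box m (X - Y)].
  have [s sP] := sl2_box_net e m.
  have [|Y _ GY] := @ultra_seq_cover _ _ G s (fun Y =>
    [set X | sl2_box m (X - Y)]) UG.
    by apply: filterS Ge => X /sP [Y Ys XY]; exists Y.
  by exists Y.
have lim i j : exists x : F, forall m,
  G [set X | prime_pow m (sl2_mx X i j - x)].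
  pose H : set_system F := (fun X => sl2_mx X i j) @ G.
  have HC : cauchy H.
    move=> A /entourage_padicP [m mA]; have [Y GY] := small m.
    pose B := [set x : F | prime_pow m (x - sl2_mx Y i j)].
    have HB : H B.
      by rewrite /H /= /fmap /=; apply: filterS GY => X /(sl2_box_entry i j);
        rewrite sl2_mxB.
    exists (B, B) => // -[x y] [/= Bx By]; apply: mA.
    rewrite (_ : x - y = (x - sl2_mx Y i j) - (y - sl2_mx Y i j)); last by ring.
    exact: prime_powB.
  have [x Hx] := padic_complete H _ HC.
  exists x => m.
  have : nbhs x [set y | prime_pow m (y - x)].
    apply/nbhsP; exists [set xy : F * F | prime_pow m (xy.1 - xy.2)].
      by apply/entourage_padicP; exists m.
    move=> y /xsectionP /= h; rewrite -opprB; exact: prime_powN.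
  by move=> /Hx.
have [a aP] := lim 0 0; have [b bP] := lim 0 1; have [c cP] := lim 1 0.
have GX m : G [set X | sl2_box m (X - sl2_of a b c)].
  apply: filterS (filterI (aP m) (filterI (bP m) (cP m))) => X [? [? ?]].
  by split; rewrite sl2_mxB sl2_ofE.
exists (sl2_of a b c); split.
  have GI : G (sl2_box e `&` [set X | sl2_box e (X - sl2_of a b c)]).
    by apply: filterI (GX e).
  have [X [eX eXl]] := filter_ex GI.
  rewrite -[sl2_of a b c](subKr X); apply: (sl2_boxD eX); exact: sl2_boxN.
move=> U /nbhs_sl2P [m mU]; apply: filterS (GX m) => X /mU.
by rewrite addrC subrK.
Qed.

(** Compactness of the support, in its near-covering form along levels n tending to infinity, makes
    both the local bound on the entries and the local level of constancy uniform. *)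
Lemma test_function_uniform (R : realType) (f : sl2 F -> R[i]) :
  test_function f -> exists d m : int, (forall X, f X != 0 -> sl2_box d X) /\
    forall X Z, sl2_box m Z -> f (X + Z) = f X.
Proof.
move=> [floc cK]; have /compact_near_coveringP {}cK := cK.
have fK X : f X != 0 -> fun_support f X by move=> ?; exact: subset_closure.
have [N1 _ HN1] : \forall n \near \oo, fun_support f `<=` sl2_box (- n%:Z).
  apply: (cK nat \oo (fun n X => sl2_box (- n%:Z) X)) => X KX.
  have [d dX] := ex_sl2_box X.
  exists ([set Y | sl2_box 0 (Y - X)], [set n : nat | (`|d|%N <= n)%N]).
    split=> /=; last by exists `|d|%N.
    by apply/nbhs_sl2P; exists 0 => Z; rewrite /= addrC addKr.
  move=> [Y n] [/= YX dn]; rewrite -(subrK X Y).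
  by apply: sl2_boxD; [apply: sl2_box_le YX|apply: sl2_box_le dX]; lia.
have [N2 _ HN2] : \forall n \near \oo, fun_support f `<=`
    [set X | forall Z, sl2_box n%:Z Z -> f (X + Z) = f X].
  apply: (cK nat \oo (fun n X =>
    forall Z, sl2_box n%:Z Z -> f (X + Z) = f X)) => X KX.
  have /nbhs_sl2P [m mX] := floc X.
  exists ([set Y | sl2_box m (Y - X)], [set n : nat | (`|m|%N <= n)%N]).
    split=> /=; last by exists `|m|%N.
    by apply/nbhs_sl2P; exists m => Z; rewrite /= addrC addKr.
  move=> [Y n] [/= YX mn] Z nZ.
  have {}nZ : sl2_box m Z by apply: sl2_box_le nZ; lia.
  rewrite -(subrK X Y) [Y - X + X]addrC -addrA mX; last exact: sl2_boxD.
  by rewrite mX.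
exists (- N1%:Z), N2%:Z; split; first by move=> X /fK; exact: HN1 (leqnn _) _.
(* Constancy is known at points of the support; if f vanishes at X but not at X + Z, it is applied
   to X + Z and -Z. *)
move=> X Z HZ; have [X0|/fK KX] := eqVneq (f X) 0;
  last exact: (HN2 N2 (leqnn _)).
have [->//|/fK KXZ] := eqVneq (f (X + Z)) 0.
have := HN2 N2 (leqnn _) _ KXZ (- Z) (sl2_boxN HZ).
by rewrite addrK.
Qed.

End Compactness.

(** * Integration of complex functions by real and imaginary parts *)

Section ComplexIntegral.
Context (R : realType) (d : measure_display) (T : measurableType d).
Variable mu : {measure set T -> \bar R}.
Implicit Types (A B : set T) (f g : T -> R[i]) (c : R[i]).

Definition Cintegrable A f : Prop :=
  mu.-integrable A (EFin \o (@complex.Re R \o f)) /\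
  mu.-integrable A (EFin \o (@complex.Im R \o f)).

Lemma complexP (x y : R[i]) :
  complex.Re x = complex.Re y -> complex.Im x = complex.Im y -> x = y.
Proof. by case: x => ? ?; case: y => ? ? /= -> ->. Qed.

Lemma eq_Cintegral A f g : (forall x, A x -> f x = g x) ->
  Cintegral mu A f = Cintegral mu A g.
Proof.
by move=> fg; rewrite /Cintegral; congr Complex;
  apply: eq_Rintegral => x /set_mem /fg ->.
Qed.

Lemma Cintegral0 A f : (forall x, A x -> f x = 0) -> Cintegral mu A f = 0.
Proof.
move=> f0; rewrite (eq_Cintegral f0) /Cintegral /=.
by apply: complexP; rewrite /= /Rintegral integral0.
Qed.

Lemma CintegrableS A B f : measurable A -> measurable B -> A `<=` B ->
  Cintegrable B f -> Cintegrable A f.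
Proof. by move=> mA mB AB [? ?]; split; apply: integrableS AB _. Qed.

Lemma Cintegral_setU A B f : measurable A -> measurable B -> [disjoint A & B] ->
  Cintegrable (A `|` B) f ->
  Cintegral mu (A `|` B) f = Cintegral mu A f + Cintegral mu B f.
Proof.
by move=> mA mB AB [? ?]; apply: complexP; rewrite /= Rintegral_setU.
Qed.

Lemma CintegralD A f g : measurable A -> Cintegrable A f -> Cintegrable A g ->
  Cintegral mu A (fun x => f x + g x) = Cintegral mu A f + Cintegral mu A g.
Proof.
move=> mA [? ?] [? ?]; apply: complexP; rewrite /= -RintegralD//;
  by apply: eq_Rintegral => x _; case: (f x); case: (g x).
Qed.

Lemma CintegrableD A f g : measurable A -> Cintegrable A f -> Cintegrable A g ->
  Cintegrable A (fun x => f x + g x).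
Proof.
move=> mA [f1 f2] [g1 g2]; split.
  apply: eq_integrable (integrableD mA f1 g1) => // x _ /=.
  by case: (f x); case: (g x).
apply: eq_integrable (integrableD mA f2 g2) => // x _ /=.
by case: (f x); case: (g x).
Qed.

Lemma CintegralZ A c f : measurable A -> Cintegrable A f ->
  Cintegral mu A (fun x => c * f x) = c * Cintegral mu A f.
Proof.
case: c => a b mA [if1 if2];
have Z (r : R) (g : T -> \bar R) := @integrableZl _ _ _ mu A mA r g.
have ZE (r : R) (g : T -> R) : mu.-integrable A (EFin \o g) ->
    mu.-integrable A (EFin \o (fun x => r * g x)).
  by move=> ig; apply: eq_integrable (Z r _ ig) => // x _.
apply: complexP => /=.
  rewrite -!RintegralZl// -RintegralB//; try exact: ZE.
  by apply: eq_Rintegral => x _; case: (f x).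
rewrite -!RintegralZl// -RintegralD//; try exact: ZE.
by apply: eq_Rintegral => x _; case: (f x).
Qed.

Lemma CintegrableZ A c f : measurable A -> Cintegrable A f ->
  Cintegrable A (fun x => c * f x).
Proof.
case: c => a b mA [if1 if2];
have Z (r : R) (g : T -> \bar R) := @integrableZl _ _ _ mu A mA r g.
split.
  apply: eq_integrable (integrableB mA (Z a _ if1) (Z b _ if2)) => // x _ /=.
  by case: (f x).
apply: eq_integrable (integrableD mA (Z a _ if2) (Z b _ if1)) => // x _ /=.
by case: (f x).
Qed.

Lemma Cintegral_restrict A B f : B `<=` A -> (forall x, A x -> ~ B x ->
  f x = 0) ->
  Cintegral mu A f = Cintegral mu B f.
Proof.
move=> BA f0; rewrite /Cintegral; congr Complex.
  rewrite -[in RHS](setIidr BA) Rintegral_mkcondr;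
    apply: eq_Rintegral => x /set_mem Ax.
  by rewrite patchE; case: ifPn => // /negP; rewrite inE => /(f0 _ Ax) ->.
rewrite -[in RHS](setIidr BA) Rintegral_mkcondr;
  apply: eq_Rintegral => x /set_mem Ax.
by rewrite patchE; case: ifPn => // /negP; rewrite inE => /(f0 _ Ax) ->.
Qed.

Lemma Cintegrable_restrict A B f : measurable A -> measurable B -> B `<=` A ->
  (forall x, A x -> ~ B x -> f x = 0) -> Cintegrable B f -> Cintegrable A f.
Proof.
move=> mA mB BA f0 [if1 if2].
have f0' x : x \in A -> x \notin B -> f x = 0.
  by move=> /set_mem Ax /negP; rewrite inE; exact: f0.
have BAm x : x \in B -> x \in A by move=> /set_mem /BA /mem_set.
split; apply/(integrable_mkcond _ mA).
  move/(integrable_mkcond _ mB) : if1; apply: eq_integrable => // x _.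
  rewrite !patchE; case: ifPn => [/BAm ->//|xB]; case: ifPn => // xA.
  by rewrite /= f0'.
move/(integrable_mkcond _ mB) : if2; apply: eq_integrable => // x _.
rewrite !patchE; case: ifPn => [/BAm ->//|xB]; case: ifPn => // xA.
by rewrite /= f0'.
Qed.

Lemma Cintegrable_bounded A f (M : R) : measurable A -> (mu A < +oo)%E ->
  measurable_fun A (@complex.Re R \o f) ->
    measurable_fun A (@complex.Im R \o f) ->
  (forall x, A x -> `|complex.Re (f x)| <= M /\ `|complex.Im (f x)| <= M) ->
  Cintegrable A f.
Proof.
move=> mA Afin mf1 mf2 fM; split; apply: measurable_bounded_integrable => //.
  exists M; split; first exact: num_real.
  by move=> N MN x /fM [+ _] => /le_trans; apply; exact: ltW.
exists M; split; first exact: num_real.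
by move=> N MN x /fM [_ +] => /le_trans; apply; exact: ltW.
Qed.

End ComplexIntegral.

(** * Translation invariance of Haar integrals *)

Section HaarIntegral.
Context (R : realType) (F : padicFieldType).
Variable mu : {measure set (borel (sl2 F)) -> \bar R}.
Hypothesis muH : haar_measure mu.
Implicit Types (X Y Z : sl2 F).

Lemma measurable_sl2_open (U : set (sl2 F)) : open U ->
  measurable (U : set (borel (sl2 F))).
Proof. exact: sub_gen_smallest. Qed.

Lemma haar_box_fin e (A : set (borel (sl2 F))) : measurable A ->
  A `<=` sl2_box e -> (mu A < +oo)%E.
Proof.
move=> mA Ae; have [_ fin _] := muH.
apply: le_lt_trans (fin _ (@compact_sl2_box F e)).
apply: le_measure => //; rewrite inE//; apply: measurable_sl2_open.
by apply/open_sl2P => X eX; exists e => Z; exact: sl2_boxD.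
Qed.

(** Every preimage under a locally constant function is open, whatever map [p] follows it; real and
    imaginary part are the intended cases. *)
Lemma measurable_locally_constant (f : sl2 F -> R[i]) (p : R[i] -> R) :
  locally_constant f -> measurable_fun setT (p \o f : borel (sl2 F) -> R).
Proof.
move=> fl _ B mB; rewrite setTI; apply: measurable_sl2_open.
rewrite openE => X BX; have := fl X; apply: filterS => Y fY.
by rewrite /preimage /= fY.
Qed.

Lemma measurable_sl2_translation Y :
  measurable_fun setT ((fun X => X + Y) : borel (sl2 F) -> borel (sl2 F)).
Proof.
apply: (@measurability _ _ (borel (sl2 F)) (borel (sl2 F)) _ _ (@open (sl2 F)))
  => //.
move=> _ [U oU <-]; rewrite setTI; apply: measurable_sl2_open.
move: oU => /open_sl2P oU; apply/open_sl2P => X /oU [e eU].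
by exists e => Z /eU; rewrite /= addrAC.
Qed.

Lemma haar_preimage_translation Y (A : set (borel (sl2 F))) : measurable A ->
  mu ((fun X => X + Y) @^-1` A) = mu A.
Proof.
move=> mA; have [inv _ _] := muH; rewrite -(inv (- Y) A mA); congr (mu _).
apply/seteqP; split=> X /=; first by move=> AX; exists (X + Y);
  [exact: AX|rewrite [X + Y]addrC addKr].
by move=> [Z AZ <-]; rewrite addrC addNKr.
Qed.

(** The pushforward of [mu] under X |-> X + Y agrees with [mu] on measurable sets; a change of
    variables in each real component does the rest. *)
Lemma Cintegral_translation Y (H : set (borel (sl2 F))) (f : sl2 F -> R[i]) :
  locally_constant f -> measurable H ->
  Cintegrable mu ((fun X => X + Y) @^-1` H) (fun X => f (X + Y)) ->
  Cintegral mu ((fun X => X + Y) @^-1` H) (fun X => f (X + Y)) =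
  Cintegral mu H f.
Proof.
move=> fl mH [g1 g2]; set HY := _ @^-1` H in g1 g2 *.
have E (p : R[i] -> R) : mu.-integrable HY (EFin \o (fun X => p (f (X + Y)))) ->
    Rintegral mu HY (fun X => p (f (X + Y))) = Rintegral mu H (fun X =>
      p (f X)).
  move=> ip; rewrite /Rintegral; congr fine.
  have /measurable_EFinP mp := measurable_locally_constant p fl.
  pose t : borel (sl2 F) -> borel (sl2 F) := fun X => X + Y.
  transitivity (\int[pushforward mu t]_(X in H) (EFin \o (p \o f)) X)%E.
    by rewrite (integral_pushforward (measurable_sl2_translation Y) mp).
  apply: eq_measure_integral => [|mt A mA _];
    first exact: measurable_sl2_translation.
  exact: haar_preimage_translation.
by rewrite /Cintegral !E.
Qed.

End HaarIntegral.

(** * The characters X |-> psi (tr XY) *)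

Section Characters.
Context (R : realType) (F : padicFieldType).
Variable mu : {measure set (borel (sl2 F)) -> \bar R}.
Hypothesis muH : haar_measure mu.
Variable psi : F -> R[i].
Hypothesis psi_char : additive_character psi.
Hypothesis psi_cond : has_conductor_prime psi.
Implicit Types (X Y Z : sl2 F).

Definition sl2_char Y X : R[i] := psi (\tr (sl2_mx X *m sl2_mx Y)).

Lemma sl2_charD Y X Z : sl2_char Y (X + Z) = sl2_char Y X * sl2_char Y Z.
Proof.
have [psiD _] := psi_char; rewrite /sl2_char -psiD; congr psi.
by rewrite -[sl2_mx (X + Z)]/(val (X + Z)) raddfD mulmxDl raddfD.
Qed.

Lemma sl2_char_sym Y X : sl2_char Y X = sl2_char X Y.
Proof. by rewrite /sl2_char mxtrace_mulC. Qed.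

Lemma prime_ideal_trace d e X Y : 1 <= d + e -> sl2_box d X -> sl2_box e Y ->
  prime_ideal (\tr (sl2_mx X *m sl2_mx Y)).
Proof.
move=> de [Xa Xb Xc] [Ya Yb Yc]; rewrite mxtrace_mul_sl2.
apply: prime_powD; last exact: prime_powMle Xc Yb.
apply: prime_powD; last exact: prime_powMle Xb Yc.
apply: prime_powMle de _ Ya; apply: prime_powMle (prime_pow_nat _ 2) Xa.
by rewrite add0r.
Qed.

Lemma sl2_char_box d e X Y : 1 <= d + e -> sl2_box d X -> sl2_box e Y ->
  sl2_char Y X = 1.
Proof.
by have [psi1 _] := psi_cond; move=> de dX eY;
  apply/psi1/prime_ideal_trace/eY/dX.
Qed.

(** As psi is trivial on wp, the character is trivial on the ball wp^(1-e) once Y lies in wp^e. *)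
Lemma sl2_char_locally_constant Y : locally_constant (sl2_char Y).
Proof.
move=> X; have [e eY] := ex_sl2_box Y; apply/nbhs_sl2P; exists (1 - e) => Z HZ.
by rewrite /= sl2_charD (@sl2_char_box (1 - e) e Z)// ?mulr1// subrK.
Qed.

Lemma unit_complex_le1 (z : R[i]) : `|z| = 1 ->
  `|complex.Re z| <= 1 /\ `|complex.Im z| <= 1.
Proof.
move=> z1; have := add_Re2_Im2 z; rewrite z1 expr1n => -[h].
by split; rewrite -ler_sqr ?nnegrE// expr1n real_normK ?num_real// -h ?lerDl
  ?lerDr sqr_ge0.
Qed.

Lemma sl2_char_integrable Y (A : set (borel (sl2 F))) : measurable A ->
  (mu A < +oo)%E -> Cintegrable mu A (sl2_char Y).
Proof.
move=> mA Afin; have lc := sl2_char_locally_constant Y.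
apply: (@Cintegrable_bounded _ _ _ mu A (sl2_char Y) 1) => //.
- by apply: measurable_funTS; exact: measurable_locally_constant.
- by apply: measurable_funTS; exact: measurable_locally_constant.
- by move=> X _; apply: unit_complex_le1; apply: psi_char.2.
Qed.

(** Orthogonality: translation by [X0] maps H to itself and multiplies the integral by
    [sl2_char Y X0], which is not 1. *)
Lemma Cintegral_char_subgroup Y (H : set (borel (sl2 F))) X0 : measurable H ->
  (mu H < +oo)%E -> (forall X Z : sl2 F, H X -> H Z -> H (X - Z)) ->
  H X0 -> sl2_char Y X0 <> 1 -> Cintegral mu H (sl2_char Y) = 0.
Proof.
move=> mH Hfin HB HX0 nY.
have int := sl2_char_integrable Y mH Hfin.
have E : (fun X => sl2_char Y (X + X0)) = (fun X =>
  sl2_char Y X0 * sl2_char Y X).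
  by apply/funext => X; rewrite sl2_charD mulrC.
have HN0 : H (- X0) by rewrite -sub0r -{1}(subrr X0); apply/(HB)/HX0/(HB).
have HE : (fun X => X + X0) @^-1` H = H.
  apply/seteqP; split=> X /= HX; first by rewrite -(addrK X0 X); exact: HB.
  by rewrite -[X0]opprK; exact: HB.
have := @Cintegral_translation _ _ mu muH X0 H (sl2_char Y).
rewrite E HE CintegralZ// => J.
have /eqP : sl2_char Y X0 * Cintegral mu H (sl2_char Y)
  = Cintegral mu H (sl2_char Y).
  apply: J => //; [exact: sl2_char_locally_constant|exact: CintegrableZ].
rewrite -subr_eq0 -[X in _ - X]mul1r -mulrBl mulf_eq0 subr_eq0 =>
  /orP[/eqP//|/eqP//].
Qed.

End Characters.

(** The pieces are removed from A one at a time. The list may name a piece twice, hence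
    [equal or disjoint]; after its removal such a piece is disjoint from the rest of A, hence
    [contained or disjoint]. *)
Lemma Cintegral_cover (R : realType) (d : measure_display)
  (T : measurableType d)
    (mu : {measure set T -> \bar R}) (I : eqType) (s : seq I) (Q : I -> set T)
    (A : set T) (f : T -> R[i]) :
  measurable A -> Cintegrable mu A f ->
  (forall i, i \in s -> measurable (Q i) /\ Cintegral mu (Q i) f = 0) ->
  (forall i j, i \in s -> j \in s -> Q i = Q j \/ [disjoint Q i & Q j]) ->
  (forall i, i \in s -> Q i `<=` A \/ [disjoint Q i & A]) ->
  (forall x, A x -> exists2 i, i \in s & Q i x) ->
  Cintegral mu A f = 0.
Proof.
elim: s A => [|i s IH] A mA fA Q0 Qdisj QA Acov.
  by apply: Cintegral0 => x /Acov [].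
have [mQi Qi0] := Q0 i (mem_head _ _).
have IA : Cintegral mu (A `\` Q i) f = 0.
  apply: IH.
  - exact: measurableD.
  - by apply: CintegrableS fA => //; exact: measurableD.
  - by move=> j js; apply: Q0; rewrite inE js orbT.
  - by move=> j k js ks; apply: Qdisj; rewrite inE ?js ?ks orbT.
  - move=> j js; have j1 : j \in i :: s by rewrite inE js orbT.
    have [|jA] := QA j j1; last first.
      by right; move: jA; rewrite !disj_set2E => /eqP jA; apply/eqP;
        rewrite setDE setIA jA set0I.
    have [<- _|] := Qdisj j i j1 (mem_head _ _).
      by right; rewrite disj_set2E; apply/eqP;
        rewrite setDE setICA setICr setI0.
    by rewrite disj_set2E => /eqP ji jA; left => x Qx; split; [exact: jA|];
      move=> Qix; have : set0 x by rewrite -ji.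
  - move=> x [/Acov [j + Qj] nQ]; rewrite inE => /predU1P[ji|js];
      last by exists j.
    by case: nQ; rewrite -ji.
have [QiA|dA] := QA i (mem_head _ _).
  have AE : A = Q i `|` (A `\` Q i) by rewrite setDUK.
  rewrite AE Cintegral_setU ?Qi0 ?IA ?addr0//.
  - exact: measurableD.
  - by rewrite disj_set2E; apply/eqP; rewrite setDE setICA setICr setI0.
  - by rewrite -AE.
rewrite -IA; congr (Cintegral mu _ f); apply/esym/setDidPl.
by move: dA; rewrite disj_set2E setIC => /eqP.
Qed.

(** * Level sets of the discriminant and twisted lattices *)

Section DiscSets.
Variable F : padicFieldType.
Implicit Types (X Y Z : sl2 F) (i j : 'I_2) (s : F).

(** Variable indices i != j let the two off-diagonal entries exchange roles, so that both halves of
    a shell are treated at once. *)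
Lemma ord2_neq (P : 'I_2 -> 'I_2 -> Prop) : P 0 1 -> P 1 0 ->
  forall i j, i != j -> P i j.
Proof. by move=> P01 P10; apply: ord2; apply: ord2; rewrite ?eqxx. Qed.

Lemma sl2_disc_ij i j X : i != j ->
  sl2_disc X = sl2_mx X 0 0 ^+ 2 + sl2_mx X i j * sl2_mx X j i.
Proof. by move: i j; apply: ord2_neq => //; rewrite [_ 1 0 * _]mulrC. Qed.

Lemma mxtrace_mul_sl2_ij i j X Y : i != j -> \tr (sl2_mx X *m sl2_mx Y) =
  2 * sl2_mx X 0 0 * sl2_mx Y 0 0 + sl2_mx X i j * sl2_mx Y j i
  + sl2_mx X j i * sl2_mx Y i j.
Proof. by move: i j; apply: ord2_neq; rewrite mxtrace_mul_sl2 // addrAC. Qed.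

Lemma sl2_box_ij i j e X : i != j -> prime_pow e (sl2_mx X 0 0) ->
  prime_pow e (sl2_mx X i j) -> prime_pow e (sl2_mx X j i) -> sl2_box e X.
Proof. by move: i j; apply: ord2_neq => *; split. Qed.

Lemma sl2_of_ij i j (a b c : F) : i != j -> exists X,
  [/\ sl2_mx X 0 0 = a, sl2_mx X i j = b & sl2_mx X j i = c].
Proof.
move: i j; apply: ord2_neq; first by exists (sl2_of a b c); rewrite !sl2_ofE.
by exists (sl2_of a c b); rewrite !sl2_ofE.
Qed.

(** By [MP_setE] this is g_{h/2}. *)
Definition disc_set (h : int) : set (sl2 F) :=
  [set X | prime_pow h (sl2_disc X)].

(* For (i, j) = (0, 1), the conjugate by [1 0; s 1] of the lattice
   a in wp^u, b in wp^v, c in wp^w; for (i, j) = (1, 0), its transpose. *)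
Definition twisted_box i j s (u v w : int) : set (sl2 F) := [set X |
  [/\ prime_pow u (sl2_mx X 0 0 + s * sl2_mx X i j),
    prime_pow v (sl2_mx X i j) &
   prime_pow w (sl2_mx X j i - 2 * s * sl2_mx X 0 0 - s ^+ 2 * sl2_mx X i j)]].

Lemma twisted_boxB i j s u v w X Y : twisted_box i j s u v w X ->
  twisted_box i j s u v w Y -> twisted_box i j s u v w (X - Y).
Proof.
move=> [Xu Xv Xw] [Yu Yv Yw]; split; rewrite !sl2_mxB.
- rewrite (_ : _ + _ = (sl2_mx X 0 0 + s * sl2_mx X i j) -
    (sl2_mx Y 0 0 + s * sl2_mx Y i j)); last by ring.
  exact: prime_powB.
- exact: prime_powB.
- rewrite (_ : _ - _ - _ =
    (sl2_mx X j i - 2 * s * sl2_mx X 0 0 - s ^+ 2 * sl2_mx X i j) -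
    (sl2_mx Y j i - 2 * s * sl2_mx Y 0 0 - s ^+ 2 * sl2_mx Y i j));
      last by ring.
  exact: prime_powB.
Qed.

Lemma prime_pow_intM e (s x : F) : prime_pow 0 s -> prime_pow e x ->
  prime_pow e (s * x).
Proof. by apply: prime_powMle; rewrite add0r. Qed.

Lemma prime_pow_int2M (s : F) : prime_pow 0 s -> prime_pow 0 (2 * s).
Proof. by apply: prime_pow_intM; exact: prime_pow_nat. Qed.

Lemma prime_pow_intX (s : F) : prime_pow 0 s -> prime_pow 0 (s ^+ 2).
Proof. by move=> s0; rewrite expr2; exact: prime_pow_intM. Qed.

Lemma sub_box_twisted_box i j s u v w e : prime_pow 0 s ->
  u <= e -> v <= e -> w <= e -> sl2_box e `<=` twisted_box i j s u v w.
Proof.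
move=> s0 ue ve we X HX; have Hij k l := @sl2_box_entry F e X k l HX.
have s2 := prime_pow_int2M s0; have ss := prime_pow_intX s0.
split; [apply: prime_pow_le ue _|apply: prime_pow_le ve _|apply: prime_pow_le we
  _] => //.
  exact/prime_powD/prime_pow_intM.
by do 2! [apply: prime_powB; last exact: prime_pow_intM].
Qed.

Lemma sub_twisted_box_box i j s u v w e : i != j -> prime_pow 0 s ->
  e <= u -> e <= v -> e <= w -> twisted_box i j s u v w `<=` sl2_box e.
Proof.
move=> ij s0 eu ev ew X [/(prime_pow_le eu) Xu /(prime_pow_le ev)
  Xv /(prime_pow_le ew) Xw].
have s2 := prime_pow_int2M s0; have ss := prime_pow_intX s0.
have Xa : prime_pow e (sl2_mx X 0 0).
  rewrite -[sl2_mx X 0 0](addrK (s * sl2_mx X i j)).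
  exact/prime_powB/prime_pow_intM.
apply: (sl2_box_ij ij) => //.
rewrite (_ : sl2_mx X j i =
    sl2_mx X j i - 2 * s * sl2_mx X 0 0 - s ^+ 2 * sl2_mx X i j
    + 2 * s * sl2_mx X 0 0 + s ^+ 2 * sl2_mx X i j); last by ring.
by do 2! [apply: prime_powD; last exact: prime_pow_intM].
Qed.

Lemma open_twisted_box i j s u v w : prime_pow 0 s ->
  open (twisted_box i j s u v w).
Proof.
move=> s0; apply/open_sl2P => X HX.
exists (Num.max u (Num.max v w)) => Z HZ.
have HN : sl2_box (Num.max u (Num.max v w)) (- Z) by exact: sl2_boxN.
rewrite -[Z]opprK; apply: twisted_boxB => //.
by apply: sub_box_twisted_box HN => //; rewrite !le_max lexx ?orbT.
Qed.

Lemma open_sl2_box e : open (sl2_box e : set (sl2 F)).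
Proof. by apply/open_sl2P => X eX; exists e => Z; exact: sl2_boxD. Qed.

Lemma sl2_discD X Z : sl2_disc (X + Z)
  = sl2_disc X + (2 * sl2_mx X 0 0 * sl2_mx Z 0 0 +
  sl2_mx X 0 1 * sl2_mx Z 1 0 + sl2_mx X 1 0 * sl2_mx Z 0 1) + sl2_disc Z.
Proof. by rewrite /sl2_disc !sl2_mxD; ring. Qed.

(** For X in wp^d the bilinear term of [sl2_discD] is in wp^h once Z is in wp^(h-d), and the
    quadratic term once Z is integral and in wp^h. *)
Lemma sl2_disc_locally_constant h X : exists e, forall Z, sl2_box e Z ->
  prime_pow h (sl2_disc (X + Z) - sl2_disc X).
Proof.
have [d dX] := ex_sl2_box X.
exists (Num.max (h - d) (Num.max h 0)) => Z HZ.
have Z1 : sl2_box (h - d) Z by apply: sl2_box_le HZ; rewrite le_max lexx.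
have Z2 : sl2_box h Z by apply: sl2_box_le HZ; rewrite !le_max lexx orbT.
have Z3 : sl2_box 0 Z by apply: sl2_box_le HZ; rewrite !le_max lexx !orbT.
have M x y : prime_pow d x -> prime_pow (h - d) y -> prime_pow h (x * y).
  by apply: prime_powMle; rewrite addrC subrK.
case: dX Z1 Z2 Z3 => xa xb xc [za zb zc] [ya yb yc] [wa wb wc].
rewrite sl2_discD -[_ + _ + sl2_disc Z]addrA addrAC subrr add0r;
  apply: prime_powD.
  apply: prime_powD; last exact: M.
  apply: prime_powD; last exact: M.
  apply: M => //; apply: prime_pow_intM => //; exact: prime_pow_nat.
apply: prime_powD; last exact: prime_pow_intM.
by rewrite expr2; exact: prime_pow_intM.
Qed.

Lemma open_disc_set h : open (disc_set h).
Proof.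
apply/open_sl2P => X hX; have [e eP] := sl2_disc_locally_constant h X.
by exists e => Z /eP hZ; rewrite /disc_set/= -(subrK (sl2_disc X)
  (sl2_disc _)); exact: prime_powD.
Qed.

Lemma open_setC_disc_set h : open (~` disc_set h).
Proof.
apply/open_sl2P => X hX; have [e eP] := sl2_disc_locally_constant h X.
exists e => Z /eP hZ hXZ; apply: hX.
by rewrite /disc_set/= -(subKr (sl2_disc (X + Z)) (sl2_disc X));
  exact: prime_powB.
Qed.

End DiscSets.

(** * Vanishing of the character integrals over g_{-n/2} cut off to balls *)

Section CharacterIntegrals.
Context (R : realType) (F : padicFieldType).
Hypothesis Fodd : odd_residue_char F.
Variable mu : {measure set (borel (sl2 F)) -> \bar R}.
Hypothesis muH : haar_measure mu.
Variable psi : F -> R[i].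
Hypothesis psi_char : additive_character psi.
Hypothesis psi_cond : has_conductor_prime psi.
Implicit Types (X Y Z : sl2 F) (i j : 'I_2) (s : F) (n N : int).

Local Notation J Y A := (Cintegral mu A (sl2_char psi Y)).

(** In the twisted coordinates a, b, c of X the trace form is 2 a [al] + b [ga] + c Y_ij, where
    [al], Y_ij, [ga] are those of Y. If one of these leaves its dual ideal, a multiple of the basis
    vector paired with it has as trace the element [x] on which psi is nontrivial. *)
Lemma twisted_box_dual i j s u v w Y : i != j -> prime_pow 0 s ->
  ~ [/\ prime_pow (1 - u) (sl2_mx Y 0 0 + s * sl2_mx Y i j),
        prime_pow (1 - v) (sl2_mx Y j i - 2 * s * sl2_mx Y 0 0 -
          s ^+ 2 * sl2_mx Y i j) & prime_pow (1 - w) (sl2_mx Y i j)] ->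
  exists2 X, twisted_box i j s u v w X & sl2_char psi Y X <> 1.
Proof.
set al := sl2_mx Y 0 0 + _; set ga := sl2_mx Y j i - _ - _ => ij s0 nY.
have [x x0 psix] := psi_cond.2.
suff [a [b [c [au bv cw E]]]] : exists a b c, [/\ prime_pow u a, prime_pow v b,
    prime_pow w c & 2 * a * al + b * ga + c * sl2_mx Y i j = x].
  (* The matrix with twisted coordinates a, b, c. *)
  have [X [Xa Xb Xc]] := @sl2_of_ij F i j (a - s * b) b
    (c + 2 * s * a - s ^+ 2 * b) ij.
  exists X; last first.
    rewrite /sl2_char (mxtrace_mul_sl2_ij X Y ij) Xa Xb Xc -E in psix *.
    by rewrite (_ : _ + _ = 2 * a * al + b * ga + c * sl2_mx Y i j)// /al /ga;
      ring.
  split; rewrite ?Xa ?Xb ?Xc ?subrK//.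
  by rewrite (_ : _ - _ - _ = c)//; ring.
have [alP|nal] := pselect (prime_pow (1 - u) al); last first.
  (* The oddness of the residue characteristic enters here: 2 is a unit and does not change the
     valuation. *)
  have {}nal : ~ prime_pow (1 - u) (2 * al).
    move=> h; apply: (not_prime_powM (odd_not_prime2 Fodd) nal).
    by apply: prime_pow_le h; lia.
  exists (x / (2 * al)), 0, 0; split; try by left.
    by apply: prime_pow_div x0 nal; lia.
  have := not_prime_pow_neq0 nal; rewrite mulf_eq0 negb_or => /andP[? ?].
  by field; apply/andP.
have [gaP|nga] := pselect (prime_pow (1 - v) ga); last first.
  exists 0, (x / ga), 0; split; try by left.
    by apply: prime_pow_div x0 nga; lia.
  by rewrite !(mulr0, mul0r, addr0, add0r) divfK// (not_prime_pow_neq0 nga).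
have nbe : ~ prime_pow (1 - w) (sl2_mx Y i j) by move=> ?; apply: nY.
exists 0, 0, (x / sl2_mx Y i j); split; try by left.
  by apply: prime_pow_div x0 nbe; lia.
by rewrite !(mulr0, mul0r, addr0, add0r) divfK// (not_prime_pow_neq0 nbe).
Qed.

(** The discriminant of Y is the square of its twisted diagonal coordinate plus the product of the
    two others, so the numerical hypotheses put the dual lattice inside [disc_set (n + 1)]. *)
Lemma twisted_box_char n i j s u v w Y : i != j -> prime_pow 0 s ->
  n + 1 <= 2 * (1 - u) -> n + 1 <= (1 - v) + (1 - w) ->
  ~ disc_set (n + 1) Y ->
  exists2 X, twisted_box i j s u v w X & sl2_char psi Y X <> 1.
Proof.
move=> ij s0 nu nvw nY; apply: twisted_box_dual => // -[al ga be]; apply: nY.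
rewrite /disc_set/= (sl2_disc_ij Y ij).
rewrite (_ : _ + _ = (sl2_mx Y 0 0 + s * sl2_mx Y i j) *
    (sl2_mx Y 0 0 + s * sl2_mx Y i j) + (sl2_mx Y j i -
    2 * s * sl2_mx Y 0 0 - s ^+ 2 * sl2_mx Y i j) * sl2_mx Y i j); last by ring.
apply: prime_powD; last exact: prime_powMle ga be.
by apply: (prime_powMle _ al al); lia.
Qed.

Lemma measurable_twisted_box i j s u v w : prime_pow 0 s ->
  measurable (twisted_box i j s u v w : set (borel (sl2 F))).
Proof. by move=> s0; apply: measurable_sl2_open; exact: open_twisted_box. Qed.

Lemma twisted_box_fin i j s u v w : i != j -> prime_pow 0 s ->
  (mu (twisted_box i j s u v w) < +oo)%E.
Proof.
move=> ij s0.
apply: (@haar_box_fin _ _ mu muH (Num.min u (Num.min v w))).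
  exact: measurable_twisted_box.
by apply: sub_twisted_box_box; rewrite // !ge_min lexx ?orbT.
Qed.

Lemma Cintegral_twisted_box n i j s u v w Y : i != j -> prime_pow 0 s ->
  n + 1 <= 2 * (1 - u) -> n + 1 <= (1 - v) + (1 - w) ->
  ~ disc_set (n + 1) Y -> J Y (twisted_box i j s u v w) = 0.
Proof.
move=> ij s0 nu nvw /(twisted_box_char ij s0 nu nvw) [X HX psiX].
apply: (@Cintegral_char_subgroup _ _ mu muH psi psi_char psi_cond _ _ X) => //.
- exact: measurable_twisted_box.
- exact: twisted_box_fin.
- by move=> *; exact: twisted_boxB.
Qed.

Definition disc_box n N : set (sl2 F) := disc_set (- n) `&` sl2_box (- N).

Lemma measurable_disc_box n N : measurable (disc_box n N : set (borel (sl2 F))).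
Proof.
apply: measurable_sl2_open; apply: openI; first exact: open_disc_set.
exact: open_sl2_box.
Qed.

Lemma disc_box_fin n N : (mu (disc_box n N) < +oo)%E.
Proof.
apply: (@haar_box_fin _ _ mu muH (- N)); first exact: measurable_disc_box.
exact: subIsetr.
Qed.

(** * The shell between the balls wp^(1-N) and wp^-N, with [N0] = floor(n/2) *)

Section Shell.
Variables (n N0 N : int) (Y : sl2 F).
Hypotheses (N0n : 2 * N0 <= n) (nN0 : n <= 2 * N0 + 1) (N0N : N0 < N).
Hypothesis nY : ~ disc_set (n + 1) Y.

(** As X_ij has valuation exactly -N, the last condition says that [s] represents the class of -a /
    X_ij modulo wp^(N - N0), where a is the diagonal entry. *)
Definition shell_piece i j s : set (sl2 F) := [set X |
  [/\ disc_box n N X, ~ prime_pow (1 - N) (sl2_mx X i j) &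
      prime_pow (- N0) (sl2_mx X 0 0 + s * sl2_mx X i j)]].

(** With b = X_ij, the discriminant is (a + s b)^2 + b c', where c' is the third twisted coordinate.
    The square is in wp^-n because 2 N0 <= n, so for b of valuation -N the quadratic condition
    becomes the linear one c' in wp^(N - n). The subtracted lattice removes the b of larger
    valuation. *)
Lemma shell_pieceE i j s : i != j -> prime_pow 0 s -> shell_piece i j s =
  twisted_box i j s (- N0) (- N) (N - n) `\` twisted_box i j s (- N0) (1 - N)
    (N - n).
Proof.
move=> ij s0.
have E X : sl2_disc X = (sl2_mx X 0 0 + s * sl2_mx X i j) *
    (sl2_mx X 0 0 + s * sl2_mx X i j) + sl2_mx X i j *
    (sl2_mx X j i - 2 * s * sl2_mx X 0 0 - s ^+ 2 * sl2_mx X i j).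
  by rewrite (sl2_disc_ij X ij); ring.
apply/seteqP; split=> X.
  move=> [[DX BX] nb ab]; split; last by case.
  split=> //; first exact: sl2_box_entry BX.
  set c := (X in prime_pow _ X).
  have bc : prime_pow (- n) (sl2_mx X i j * c).
    rewrite (_ : _ * _ = sl2_disc X - (sl2_mx X 0 0 + s * sl2_mx X i j) *
      (sl2_mx X 0 0 + s * sl2_mx X i j)); last by rewrite E /c; ring.
    by apply: (prime_powB DX); apply: (prime_powMle _ ab ab); lia.
  rewrite -[c](mulKf (not_prime_pow_neq0 nb)) mulrC.
  by apply: prime_pow_div bc nb; lia.
move=> [HX nX]; have [ab Xb Xc] := HX; split=> //; last first.
  by move=> Xb'; apply: nX.
split; last by apply: sub_twisted_box_box HX => //; lia.
rewrite /disc_set/= E; apply: prime_powD; last by apply: prime_powMle Xb Xc;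
  lia.
by apply: (prime_powMle _ ab ab); lia.
Qed.

Lemma measurable_shell_piece i j s : i != j -> prime_pow 0 s ->
  measurable (shell_piece i j s : set (borel (sl2 F))).
Proof.
by move=> ij s0; rewrite shell_pieceE//; apply: measurableD;
  exact: measurable_twisted_box.
Qed.

(** Both lattices meet the bounds of [Cintegral_twisted_box]: the diagonal one is n <= 2 N0 + 1, and
    the dual off-diagonal exponents add up to n + 2 for the larger lattice and to exactly n + 1 for
    the smaller. *)
Lemma Cintegral_shell_piece i j s : i != j -> prime_pow 0 s ->
  J Y (shell_piece i j s) = 0.
Proof.
move=> ij s0; rewrite shell_pieceE//.
set H1 := twisted_box _ _ _ _ (- N) _; set H2 := twisted_box _ _ _ _ _ _.
have mH1 : measurable (H1 : set (borel (sl2 F)))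
  by exact: measurable_twisted_box.
have mH2 : measurable (H2 : set (borel (sl2 F)))
  by exact: measurable_twisted_box.
have H12 : H2 `|` (H1 `\` H2) = H1.
  by rewrite setDUK// => X [? Xb ?]; split=> //; apply: prime_pow_le Xb; lia.
have JH1 : J Y H1 = 0 by apply: (@Cintegral_twisted_box n); rewrite //; lia.
have JH2 : J Y H2 = 0 by apply: (@Cintegral_twisted_box n); rewrite //; lia.
rewrite -JH1 -[in RHS]H12 Cintegral_setU ?JH2 ?add0r//.
- exact: measurableD.
- by rewrite disj_set2E; apply/eqP; rewrite setDE setICA setICr setI0.
- rewrite H12; apply: sl2_char_integrable => //; exact: twisted_box_fin.
Qed.

(** Used with [e] = 0 when the upper entry has valuation -N, and with [e] = 1 when the lower one
    has; the smaller diagonal in the second case keeps the two sets disjoint. *)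
Definition shell i j (e : int) : set (sl2 F) := [set X |
  [/\ disc_box n N X, ~ prime_pow (1 - N) (sl2_mx X i j) &
      prime_pow (e - N) (sl2_mx X 0 0)]].

Lemma measurable_shell i j e : measurable (shell i j e : set (borel (sl2 F))).
Proof.
rewrite (_ : shell i j e = disc_box n N `&`
  [set X | ~ prime_pow (1 - N) (sl2_mx X i j)]
  `&` [set X | prime_pow (e - N) (sl2_mx X 0 0)]); last first.
  by apply/seteqP; split=> X; [move=> [? ? ?]|move=> [[? ?] ?]].
apply: measurableI; first apply: measurableI; first exact: measurable_disc_box.
  apply: measurable_sl2_open; apply/open_sl2P => X HX; exists (1 - N) => Z HZ.
  move=> HXZ; apply: HX; rewrite -(addrK (sl2_mx Z i j) (sl2_mx X i j))
    -sl2_mxD.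
  by apply: (prime_powB HXZ); exact: sl2_box_entry HZ.
apply: measurable_sl2_open; apply/open_sl2P => X HX; exists (e - N) => Z HZ.
by rewrite /= sl2_mxD; apply: (prime_powD HX); exact: sl2_box_entry HZ.
Qed.

(** The quotient -a / X_ij lies in wp^e, so finitely many representatives modulo wp^(N - N0) give
    pieces that cover the shell; two pieces coincide or are disjoint according to the classes of
    their parameters. *)
Lemma Cintegral_shell i j e : i != j -> 0 <= e <= 1 ->
  J Y (shell i j e) = 0.
Proof.
set A := shell i j e => ij /andP[e0 e1].
have [l [le lP]] := prime_pow_net F e (N - N0).
have l0 s : s \in l -> prime_pow 0 s by move=> /le; exact: prime_pow_le.
have mA : measurable (A : set (borel (sl2 F))) by exact: measurable_shell.
have pieceA s : s \in l -> shell_piece i j s `<=` A.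
  move=> /le se X [DX nb ab]; split=> //.
  rewrite -[sl2_mx X 0 0](addrK (s * sl2_mx X i j)); apply: prime_powB.
    by apply: prime_pow_le ab; lia.
  by apply: prime_powMle se (sl2_box_entry i j DX.2); lia.
apply: (@Cintegral_cover _ _ _ mu _ l (shell_piece i j) _ _ mA).
- apply: sl2_char_integrable => //.
  apply: le_lt_trans (disc_box_fin n N); apply: le_measure; rewrite ?inE//.
    exact: measurable_disc_box.
  by move=> X [].
- move=> s /l0 s0; split; first exact: measurable_shell_piece.
  exact: Cintegral_shell_piece.
- move=> s t sl tl; rewrite disj_set2E.
  have [st0|/set0P [X [[DX nb Xs] [_ _ Xt]]]] :=
    eqVneq (shell_piece i j s `&` shell_piece i j t) set0.
    by right; apply/eqP.
  (* A common point X gives (s - t) X_ij in wp^-N0, with X_ij of valuation -N. *)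
  left; have st : prime_pow (N - N0) (s - t).
    rewrite -[s - t](mulfK (not_prime_pow_neq0 nb)).
    apply: (@prime_pow_div _ _ (- N0) _ _ _ _ _ nb); first by lia.
    rewrite (_ : _ * _ = (sl2_mx X 0 0 + s * sl2_mx X i j) -
      (sl2_mx X 0 0 + t * sl2_mx X i j)); last by ring.
    exact: prime_powB.
  have sub s' t' : prime_pow (N - N0) (s' - t') ->
      shell_piece i j s' `<=` shell_piece i j t'.
    move=> st' Z [DZ nZ Zs]; split=> //.
    rewrite (_ : _ + _ = (sl2_mx Z 0 0 + s' * sl2_mx Z i j) -
      (s' - t') * sl2_mx Z i j); last by ring.
    apply: (prime_powB Zs); apply: prime_powMle st' (sl2_box_entry i j DZ.2);
      lia.
  by apply/seteqP; split; apply: sub => //; rewrite -[t - s]opprB;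
    exact: prime_powN.
- by move=> s sl; left; exact: pieceA.
- move=> X [DX nb Xa].
  have [|s sl sX] := lP (- (sl2_mx X 0 0 / sl2_mx X i j)).
    by apply: prime_powN; apply: prime_pow_div Xa nb; lia.
  exists s => //; split=> //.
  rewrite (_ : _ + _ = - ((- (sl2_mx X 0 0 / sl2_mx X i j) - s)
    * sl2_mx X i j)).
    by apply: prime_powN; apply: prime_powMle sX (sl2_box_entry i j DX.2); lia.
  by field; exact: not_prime_pow_neq0 nb.
Qed.

Lemma Cintegral_disc_box_step : J Y (disc_box n N) = J Y (disc_box n (N - 1)).
Proof.
have [j01 j10] : (0 : 'I_2) != 1 /\ (1 : 'I_2) != 0 by [].
pose P1 := shell 0 1 0; pose P2 := shell 1 0 1.
have mP1 : measurable (P1 : set (borel (sl2 F))) by exact: measurable_shell.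
have mP2 : measurable (P2 : set (borel (sl2 F))) by exact: measurable_shell.
have JP1 : J Y P1 = 0 by exact: Cintegral_shell.
have JP2 : J Y P2 = 0 by exact: Cintegral_shell.
(* Since n <= 2N - 1, a^2 = disc - bc lies in wp^(1 - 2N) as soon as b is in wp^(1 - N); integrality
   of valuations gives a in wp^(1 - N). *)
have sqr X : disc_box n N X -> prime_pow (1 - N) (sl2_mx X 0 1) ->
    prime_pow (1 - N) (sl2_mx X 0 0).
  move=> [DX BX] Xb; apply: prime_pow_sqr.
  rewrite (_ : _ ^+ 2 = sl2_disc X - sl2_mx X 0 1 * sl2_mx X 1 0); last first.
    by rewrite /sl2_disc; ring.
  apply: prime_powB; first by apply: prime_pow_le DX; lia.
  by apply: prime_powMle Xb (sl2_box_entry 1 0 BX); lia.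
have E : disc_box n N = P1 `|` (P2 `|` disc_box n (N - 1)).
  apply/seteqP; split=> X.
    move=> DX; have [Xb|Xb] := pselect (prime_pow (1 - N) (sl2_mx X 0 1));
      last first.
      by left; split=> //; rewrite sub0r; exact: sl2_box_entry DX.2.
    have Xa := sqr X DX Xb; right.
    have [Xc|Xc] := pselect (prime_pow (1 - N) (sl2_mx X 1 0)); last by left.
    by right; split; [exact: DX.1|rewrite opprB].
  move=> [[]//|[[]//|[DX BX]]]; split=> //; apply: sl2_box_le BX; lia.
have d2 : [disjoint P2 & disc_box n (N - 1)].
  rewrite disj_set2E; apply/eqP/seteqP; split=> // X [[_ nc _] [_ BX]];
    apply: nc.
  by have := sl2_box_entry 1 0 BX; rewrite opprB.
have d1 : [disjoint P1 & P2 `|` disc_box n (N - 1)].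
  rewrite disj_set2E; apply/eqP/seteqP; split=> // X [[_ nb _]] [PX|[_ BX]];
    apply: nb; last first.
    by have := sl2_box_entry 0 1 BX; rewrite opprB.
  (* On [P2] the product bc = disc - a^2 lies in wp^(1 - 2N) while c has valuation -N, so b is in
     wp^(1 - N), which [P1] excludes. *)
  case: PX => DX nc Xa.
  rewrite -(mulfK (not_prime_pow_neq0 nc) (sl2_mx X 0 1)).
  apply: (@prime_pow_div _ _ (1 - N - N) _ _ _ _ _ nc); first by lia.
  rewrite (_ : _ * _ = sl2_disc X - sl2_mx X 0 0 * sl2_mx X 0 0); last first.
    by rewrite /sl2_disc; ring.
  apply: prime_powB; first by apply: prime_pow_le DX.1; lia.
  by apply: prime_powMle Xa (sl2_box_entry 0 0 DX.2); lia.
have int (A : set (borel (sl2 F))) : measurable A -> A `<=` disc_box n N ->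
    Cintegrable mu A (sl2_char psi Y).
  move=> mA AD; apply: CintegrableS AD _ => //;
    first exact: measurable_disc_box.
  apply: sl2_char_integrable => //; first exact: measurable_disc_box.
  exact: disc_box_fin.
have mD := measurable_disc_box n (N - 1).
rewrite E Cintegral_setU//; first 1 last.
- exact: measurableU.
- by apply: int; [apply: measurableU => //; exact: measurableU|rewrite -E].
rewrite JP1 add0r Cintegral_setU ?JP2 ?add0r//.
by apply: int; [exact: measurableU|rewrite E; exact: subsetUr].
Qed.

End Shell.

Lemma Cintegral_disc_box (n : nat) (N : int) Y :
  n./2%:Z <= N -> ~ disc_set (n%:Z + 1) Y -> J Y (disc_box n N) = 0.
Proof.
move=> nN nY; have [N0n nN0] : 2 * n./2%:Z <= n /\ n <= 2 * n./2%:Z + 1 :> int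
  by lia.
have -> : N = n./2%:Z + `|N - n./2%:Z|%N by lia.
elim: `|_|%N => [|k IH]; last first.
  rewrite (@Cintegral_disc_box_step n n./2) //; last by lia.
  by rewrite -IH; congr (J Y (disc_box _ _)); lia.
(* Matrices in this smallest ball have discriminant in wp^-n automatically, so the set is the ball
   itself, a twisted box with [s] = 0. *)
rewrite addr0 (_ : disc_box n n./2 = twisted_box 0 1 0 (- n./2%:Z) (- n./2%:Z)
  (- n./2%:Z)).
  apply: (@Cintegral_twisted_box n) => //; [exact: prime_pow0|lia|lia].
have z0 := prime_pow0 F 0.
apply/seteqP; split=> X; first by move=> [_]; exact: sub_box_twisted_box.
move=> /(sub_twisted_box_box (isT : (0 : 'I_2) != 1) z0 (lexx _) (lexx _)
  (lexx _)) BX; split=> //.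
apply: prime_powD; last by apply: prime_powMle (sl2_box_entry 0 1 BX)
  (sl2_box_entry 1 0 BX); lia.
have Xa := sl2_box_entry 0 0 BX.
by apply: (prime_powMle _ Xa Xa); lia.
Qed.

End CharacterIntegrals.

(** * Fourier transforms of test functions and the support of the distribution *)

Section FourierTransform.
Context (R : realType) (F : padicFieldType).
Hypothesis Fodd : odd_residue_char F.
Variable mu : {measure set (borel (sl2 F)) -> \bar R}.
Hypothesis muH : haar_measure mu.
Variable psi : F -> R[i].
Hypothesis psi_char : additive_character psi.
Hypothesis psi_cond : has_conductor_prime psi.
Implicit Types (X Y Z : sl2 F).

Definition sl2_coset (m : int) Y0 : set (sl2 F) := [set X | sl2_box m (X - Y0)].

Definition coset_ind (m : int) Y X : R[i] := (`[< sl2_box m (X - Y) >])%:R.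

Definition coset_vol (m : int) : R[i] := Cintegral mu (sl2_box m) (fun=> 1).

Lemma coset_ind_invariant m Y X Z : sl2_box m Z ->
  coset_ind m Y (X + Z) = coset_ind m Y X.
Proof.
move=> mZ; rewrite /coset_ind addrAC; congr (nat_of_bool _)%:R.
apply: asbool_equiv_eq; split=> h; last exact: sl2_boxD.
by rewrite -(addrK Z (X - Y)); apply: (sl2_boxD h); exact: sl2_boxN.
Qed.

(** The ball wp^(1-m) is dual to wp^m, as psi has conductor wp and 2 is a unit; for Y in it the
    character is trivial, otherwise orthogonality applies. *)
Lemma Cintegral_box_char m Y : Cintegral mu (sl2_box m) (sl2_char psi Y) =
  coset_vol m * (`[< sl2_box (1 - m) Y >])%:R.
Proof.
have mB : measurable (sl2_box m : set (borel (sl2 F))).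
  by apply: measurable_sl2_open; exact: open_sl2_box.
case: asboolP => [YB|nYB].
  rewrite mulr1; apply: eq_Cintegral => X mX.
  by apply: (sl2_char_box psi_cond _ mX YB); lia.
have j01 : (0 : 'I_2) != 1 by [].
have [|X HX psiX] := @twisted_box_dual _ _ Fodd _ psi_cond 0 1 0 m m m Y j01
  (prime_pow0 F 0).
  rewrite mul0r mulr0 mul0r expr0n mul0r !subr0 addr0 => -[? ? ?].
  by apply: nYB; split.
rewrite mulr0; apply: (@Cintegral_char_subgroup _ _ mu muH psi psi_char psi_cond
  _ _ X) => //.
- by apply: (@haar_box_fin _ _ mu muH m).
- by move=> Z1 Z2 ? ?; apply: sl2_boxD => //; exact: sl2_boxN.
- by apply: sub_twisted_box_box HX => //; exact: prime_pow0.
Qed.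

Lemma open_coset m Y0 : open (sl2_coset m Y0).
Proof.
apply/open_sl2P => X HX; exists m => Z mZ.
by rewrite /sl2_coset/= addrAC; exact: sl2_boxD.
Qed.

Lemma coset_translate m Y0 :
  (fun X : sl2 F => X + Y0) @^-1` sl2_coset m Y0 = sl2_box m.
Proof. by apply/seteqP; split=> X; rewrite /sl2_coset/= addrK. Qed.

Lemma measurable_sl2_box m : measurable (sl2_box m : set (borel (sl2 F))).
Proof. by apply: measurable_sl2_open; exact: open_sl2_box. Qed.

Lemma haar_coset_fin m Y0 :
  (mu (sl2_coset m Y0 : set (borel (sl2 F))) < +oo)%E.
Proof.
have mC := measurable_sl2_open (open_coset m Y0).
rewrite -(haar_preimage_translation muH Y0 mC) coset_translate.
by apply: (@haar_box_fin _ _ mu muH m) => //; exact: measurable_sl2_box.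
Qed.

Lemma coset_ind_out m Y0 X : ~ sl2_box m (X - Y0) -> coset_ind m Y0 X = 0.
Proof. by move=> h; rewrite /coset_ind asboolF. Qed.

Lemma coset_ind_in m Y0 X : sl2_box m (X - Y0) -> coset_ind m Y0 X = 1.
Proof. by move=> h; rewrite /coset_ind asboolT. Qed.

Lemma Cintegrable_coset_ind m Y0 Y :
  Cintegrable mu setT (fun X => sl2_char psi Y X * coset_ind m Y0 X).
Proof.
have mC := measurable_sl2_open (open_coset m Y0).
apply: (@Cintegrable_restrict _ _ _ mu setT _ _ measurableT mC) => //.
  by move=> X _ nX; rewrite coset_ind_out ?mulr0.
have [int1 int2] := sl2_char_integrable psi_char psi_cond Y mC (haar_coset_fin m
  Y0).
split.
  apply: eq_integrable int1 => // X /set_mem HX /=.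
  by rewrite coset_ind_in// mulr1.
apply: eq_integrable int2 => // X /set_mem HX /=.
by rewrite coset_ind_in// mulr1.
Qed.

(** Translating the coset to the ball extracts the factor psi (tr Y0 Y), and [Cintegral_box_char]
    evaluates the rest. *)
Lemma FT_coset_ind m Y0 Y : FT mu psi (coset_ind m Y0) Y =
  sl2_char psi Y0 Y * (coset_vol m * (`[< sl2_box (1 - m) Y >])%:R).
Proof.
have mC := measurable_sl2_open (open_coset m Y0).
rewrite /FT -/(sl2_char psi Y _).
rewrite (@Cintegral_restrict _ _ _ mu setT (sl2_coset m Y0))//; last first.
  by move=> X _ nX; rewrite coset_ind_out ?mulr0.
rewrite (@eq_Cintegral _ _ _ mu _ _ (sl2_char psi Y)); last first.
  by move=> X HX; rewrite coset_ind_in// mulr1.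
have mB := measurable_sl2_box m.
have B_fin : (mu (sl2_box m) < +oo)%E by apply: (@haar_box_fin _ _ mu muH m).
have iB := sl2_char_integrable psi_char psi_cond Y mB B_fin.
have E : (fun X => sl2_char psi Y (X + Y0)) =
    (fun X => sl2_char psi Y Y0 * sl2_char psi Y X).
  by apply/funext => X; rewrite sl2_charD// mulrC.
have := @Cintegral_translation _ _ mu muH Y0 (sl2_coset m Y0) (sl2_char psi Y)
  (sl2_char_locally_constant psi_char psi_cond Y) mC.
rewrite coset_translate E => <-; last exact: CintegrableZ.
by rewrite CintegralZ// Cintegral_box_char sl2_char_sym.
Qed.

(** By [FT_coset_ind] the integrand is a multiple of [sl2_char psi Y0] cut off to wp^(1-m). What
    remains is the integral over [disc_box n (m - 1)], and the bound on m is that of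
    [Cintegral_disc_box] for N = m - 1. *)
Lemma Cintegral_FT_coset_ind (n : nat) (m : int) Y0 :
  n./2%:Z + 1 <= m -> ~ disc_set (n%:Z + 1) Y0 ->
  Cintegrable mu (disc_set (- n%:Z)) (FT mu psi (coset_ind m Y0)) /\
  Cintegral mu (disc_set (- n%:Z)) (FT mu psi (coset_ind m Y0)) = 0.
Proof.
move=> nm nY0; have mD : measurable (disc_set (- n%:Z) : set (borel (sl2 F))).
  by apply: measurable_sl2_open; exact: open_disc_set.
have mDB := @measurable_disc_box F n (m - 1).
have out X : disc_set (- n%:Z) X -> ~ disc_box n (m - 1) X ->
    FT mu psi (coset_ind m Y0) X = 0.
  move=> DX nX; rewrite FT_coset_ind asboolF ?mulr0// => BX; apply: nX.
  by split=> //; rewrite opprB.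
have inn X : disc_box n (m - 1) X ->
    FT mu psi (coset_ind m Y0) X = coset_vol m * sl2_char psi Y0 X.
  by move=> [_]; rewrite opprB => BX;
    rewrite FT_coset_ind asboolT// mulr1 mulrC.
have iDB := sl2_char_integrable psi_char psi_cond Y0 mDB (disc_box_fin muH n (m
  - 1)).
split.
  apply: (Cintegrable_restrict mD mDB) => //; first exact: subIsetl.
  have [i1 i2] := CintegrableZ (coset_vol m) mDB iDB; split.
    by apply: eq_integrable i1 => // X /set_mem HX; rewrite /comp inn.
  by apply: eq_integrable i2 => // X /set_mem HX; rewrite /comp inn.
rewrite (@Cintegral_restrict _ _ _ mu _ (disc_box n (m - 1)))//;
  last exact: subIsetl.
rewrite (eq_Cintegral mu inn) CintegralZ// Cintegral_disc_box ?mulr0//.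
by lia.
Qed.

(** Induction on the list of coset representatives. The first integrability makes [FT] additive in
    the induction step, the second makes the outer integral additive. *)
Lemma Cintegral_FT_disc_set (n : nat) (m : int) (s : seq (sl2 F))
  (f : sl2 F -> R[i]) :
  n./2%:Z + 1 <= m -> (forall X Z, sl2_box m Z -> f (X + Z) = f X) ->
  (forall X, f X != 0 -> exists2 Y, Y \in s & sl2_box m (X - Y)) ->
  (forall X, f X != 0 -> ~ disc_set (n%:Z + 1) X) ->
  [/\ forall Y, Cintegrable mu setT (fun X => sl2_char psi Y X * f X),
      Cintegrable mu (disc_set (- n%:Z)) (FT mu psi f) &
      Cintegral mu (disc_set (- n%:Z)) (FT mu psi f) = 0].
Proof.
move=> nm; have mD : measurable (disc_set (- n%:Z) : set (borel (sl2 F))).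
  by apply: measurable_sl2_open; exact: open_disc_set.
have Cint0 (A : set (borel (sl2 F))) (g : sl2 F -> R[i]) : measurable A ->
    (forall X, g X = 0) -> Cintegrable mu A g.
  move=> mA g0; have -> : g = fun=> 0 by exact/funext.
  by split; exact: integrable0.
elim: s f => [|Y0 s IH] f finv fs fD.
  have f0 X : f X = 0 by apply/eqP; apply: contraT => /fs [].
  have FT0 Y : FT mu psi f Y = 0 by apply: Cintegral0 => X _; rewrite f0 mulr0.
  split; [|exact: Cint0|by apply: Cintegral0 => X _; exact: FT0].
  by move=> Y; apply: Cint0 => // X; rewrite f0 mulr0.
have fcoset X Y : sl2_box m (X - Y) -> f X = f Y.
  by move=> XY; rewrite -(finv Y _ XY) addrC subrK.
have [fY0|fY0] := eqVneq (f Y0) 0.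
  apply: IH => // X fX; have [Y + XY] := fs X fX.
  rewrite inE => /predU1P[YY0|]; last by exists Y.
  by move: fX; rewrite (fcoset X Y)// YY0 fY0 eqxx.
(* This vanishes on the coset of [Y0] and agrees with f elsewhere, so the tail [s] covers its
   nonzero points. *)
pose h X := f X - f Y0 * coset_ind m Y0 X.
have hout X : h X != 0 -> ~ sl2_box m (X - Y0) /\ h X = f X.
  move=> hX; have [XY|nXY] := pselect (sl2_box m (X - Y0)); last first.
    by split=> //; rewrite /h coset_ind_out// mulr0 subr0.
  by move: hX; rewrite /h coset_ind_in// mulr1 (fcoset X Y0)// subrr eqxx.
have [||| hT hD hD0] := IH h.
- by move=> X Z mZ; rewrite /h finv// coset_ind_invariant.
- move=> X hX; have [nXY hf] := hout X hX.
  have [|Y + XY] := fs X; first by rewrite -hf.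
  by rewrite inE => /predU1P[YY0|]; [rewrite YY0 in XY|exists Y].
- by move=> X hX; have [_ hf] := hout X hX; apply: fD; rewrite -hf.
have fE X : f X = f Y0 * coset_ind m Y0 X + h X by rewrite /h addrC subrK.
have [iD iD0] := Cintegral_FT_coset_ind nm (fD Y0 fY0).
have fE' Y X : sl2_char psi Y X * f X =
    f Y0 * (sl2_char psi Y X * coset_ind m Y0 X) + sl2_char psi Y X * h X.
  by rewrite fE mulrDr mulrCA.
have fEfun Y : (fun X => sl2_char psi Y X * f X) = (fun X =>
    f Y0 * (sl2_char psi Y X * coset_ind m Y0 X) + sl2_char psi Y X * h X).
  by apply/funext => X; exact: fE'.
have iZ Y := CintegrableZ (f Y0) (@measurableT _ (borel (sl2 F)))
  (Cintegrable_coset_ind m Y0 Y).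
have FTE : FT mu psi f = fun Y =>
  f Y0 * FT mu psi (coset_ind m Y0) Y + FT mu psi h Y.
  apply/funext => Y; rewrite /FT -/(sl2_char psi Y) fEfun CintegralD//.
  by rewrite CintegralZ//; exact: Cintegrable_coset_ind.
split.
- by move=> Y; rewrite fEfun; exact: CintegrableD.
- by rewrite FTE; apply: CintegrableD => //; exact: CintegrableZ.
- by rewrite FTE CintegralD ?CintegralZ ?iD0 ?hD0 ?mulr0 ?addr0//;
    exact: CintegrableZ.
Qed.

(** The complement of [disc_set (n + 1)] is open, so it suffices that the functional kills the test
    functions supported there. *)
Lemma dist_support_FT_disc_set (n : nat) :
  dist_support (dist_FT mu psi (dist_ind mu (disc_set (- n%:Z)))) `<=`
  disc_set (n%:Z + 1).
Proof.
move=> X suppX; apply: contrapT => nX; apply: suppX.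
exists (~` disc_set (n%:Z + 1)); split=> //; first exact: open_setC_disc_set.
move=> f tf fU; have [d [e [fd fe]]] := test_function_uniform tf.
(* Fine enough for f to be constant on cosets, and for the bound of [Cintegral_FT_disc_set]. *)
pose m := Num.max e (n./2%:Z + 1).
have [s sP] := sl2_box_net F d m.
have [||||_ _ J0] := @Cintegral_FT_disc_set n m s f; last exact: J0.
- by rewrite le_max lexx orbT.
- by move=> Y Z mZ; apply: fe; apply: sl2_box_le mZ; rewrite le_max lexx.
- by move=> Y /fd /sP.
- by move=> Y fY; apply: fU; exact: subset_closure.
Qed.

End FourierTransform.

Theorem propositionA1 (R : realType) (F : padicFieldType)
    (Fodd : odd_residue_char F)
    (mu : {measure set (borel (sl2 F)) -> \bar R}) (muH : haar_measure mu)
    (psi : F -> R[i]) (psi_char : additive_character psi)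
    (psi_cond : has_conductor_prime psi) :
  [/\ [/\ dist_support (dist_FT mu psi (dist_ind mu (MP_set F (0 : R))))
            `<=` MP_set F (2^-1 : R),
          dist_support (dist_FT mu psi (dist_ind mu (MP_set F (- 2^-1 : R))))
            `<=` MP_set F (1 : R),
          dist_support (dist_FT mu psi (dist_ind mu (MP_set F (0 : R))))
            `<=` top_nilpotent F &
          dist_support (dist_FT mu psi (dist_ind mu (MP_set F (- 2^-1 : R))))
            `<=` top_nilpotent F] &
      forall k : R, (exists n : nat, k = n%:R / 2) -> 1 <= k ->
        dist_support (dist_FT mu psi (dist_ind mu (MP_set F (- k))))
          `<=` MP_set F (k + 2^-1)].
Proof.
(* Every claim is an instance: n = 0 and n = 1 for the first part, k = n/2 for the second. *)
have main (n : nat) : dist_support (dist_FT mu psi (dist_ind mu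
    (MP_set F (- (n%:R / 2) : R)))) `<=` disc_set (n%:Z + 1).
  rewrite (_ : - (n%:R / 2) = (- n%:Z)%:~R / 2 :> R); last by rewrite rmorphN mulNr.
  by rewrite MP_setE; exact: dist_support_FT_disc_set.
have MPE (n : nat) : MP_set F (n%:R / 2 + 2^-1 : R) = disc_set (n%:Z + 1).
  by rewrite -[RHS](MP_setE R); congr MP_set; rewrite rmorphD mulrDl mul1r.
have nil (h : int) : 1 <= h -> @disc_set F h `<=` top_nilpotent F.
  by move=> h1 X hX; apply: top_nilpotentE; exact: prime_pow_le hX.
have E0 : 0 = - (0%:R / 2) :> R by rewrite mul0r oppr0.
have E1 : - 2^-1 = - (1%:R / 2) :> R by rewrite mul1r.
split; last by move=> k [n ->] _; rewrite MPE.
split.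
- by have := main 0%N; rewrite -MPE -E0 mul0r add0r.
- have := main 1%N; rewrite -MPE -E1 (_ : 1%:R / 2 + 2^-1 = 1)//.
  by field.
- by rewrite E0; apply: subset_trans (main 0%N) _; exact: nil.
- by rewrite E1; apply: subset_trans (main 1%N) _; exact: nil.
Qed.
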